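(* Consider the $GI^X/M/c$ queueing model with batch arrivals, with stationary pre-arrival probabilities $\pi(k)$ and batch-size tail $B^c(m)=\sum_{i=m}^{\infty}b(i)$. Then the time-average system size probabilities $p(n)$, $n=0,1,\dots$, are given by \[ p(n)=\frac{\lambda\sum_{k=0}^{n-1}\pi(k)B^c(n-k)}{\min(n,c)\,\mu},\quad n=1,2,\dots;\qquad p(0)=1-\sum_{k=1}^{\infty}p(k). \]
   Context: The $GI^X/M/c$ model: customers arrive in batches to an infinite-capacity system with $c\ge 1$ parallel identical servers. The times between batch arrivals are i.i.d. with distribution function $A(t)$ and mean $1/\lambda$ (so $\lambda$ is the batch arrival rate); batch sizes are i.i.d. copies of $X$ with support in $\{1,2,\dots\}$ and $b(k)=P(X=k)$; service times are i.i.d. exponential with mean $1/\mu$; all are mutually independent. When $n$ customers are present the total service rate is $\min(n,c)\mu$. The model is assumed stable, $\rho=\lambda E[X]/(c\mu)<1$. $\pi(k)$ is the stationary (limiting) probability that an arriving batch finds $k$ customers in the system. With $X(t)$ the number of customers in the system at time $t$, $p(n)=\lim_{t\to\infty}P\{X(t)=n\}$ is the time-average stationary distribution; these stationary distributions are assumed to exist. *)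

(* Defs.v *)
From HB Require Import structures.
From mathcomp Require Import all_boot all_order all_algebra.
From mathcomp Require Import all_classical all_reals all_analysis.

Set Implicit Arguments.
Unset Strict Implicit.
Unset Printing Implicit Defensive.

Import Order.TTheory GRing.Theory Num.Theory.
Import numFieldNormedType.Exports.

Local Open Scope classical_set_scope.
Local Open Scope ring_scope.

(* One sample path of the data driving a first-come first-served queue with
   batch arrivals.  Batches and customers are numbered from 0 in order of
   arrival; customers already present at time 0 get the numbers below
   [initial], and their service times are taken from the same sequence
   [service]. *)

Record queue_input (R : realType) := QueueInput {
  initial : nat;          (* number of customers present at time 0 *)
  first_arrival : R;      (* arrival epoch of batch 0 *)
  gap : nat -> R;         (* time between the arrivals of batches i and i+1 *)
  batch_size : nat -> nat;
  service : nat -> R      (* service time of customer j *)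
}.

Definition arrival_epoch (R : realType) (x : queue_input R) (i : nat) : R :=
  first_arrival x + \sum_(l < i) gap x l.

Definition customers_before (R : realType) (x : queue_input R) (i : nat) : nat :=
  (initial x + \sum_(l < i) batch_size x l)%N.

(* For j >= initial x this is the i such that
     customers_before x i <= j < customers_before x i.+1,
   obtained by counting the batches that consist of customers numbered below j;
   since batch sizes are positive, all of these have an index below j. *)
Definition batch_of (R : realType) (x : queue_input R) (j : nat) : nat :=
  (\sum_(i < j) (customers_before x i.+1 <= j))%N.

Definition customer_arrival (R : realType) (x : queue_input R) (j : nat) : R :=
  if (j < initial x)%N then 0 else arrival_epoch x (batch_of x j).

(* Kiefer-Wolfowitz recursion: the increasing list of the c epochs at which the
   servers become free of customers 0, ..., j - 1.  Customer j takes the server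
   which becomes free first. *)
Fixpoint free_epochs (R : realType) (c : nat) (x : queue_input R) (j : nat) :
    seq R :=
  if j is j'.+1 then
    let v := free_epochs c x j' in
    sort <=%R ((Num.max (customer_arrival x j') (head 0 v) + service x j')
               :: behead v)
  else nseq c 0.

Definition departure (R : realType) (c : nat) (x : queue_input R) (j : nat) : R :=
  Num.max (customer_arrival x j) (head 0 (free_epochs c x j)) + service x j.

Definition in_system (R : realType) (c : nat) (x : queue_input R) (t : R) :
    set nat :=
  [set j | customer_arrival x j <= t < departure c x j].

(* Arrivals are ordered by batch number, so that if several batches happen to
   arrive at the same epoch, each one finds the customers of the previous
   ones. *)
Definition found_by_batch (R : realType) (c : nat) (x : queue_input R) (i : nat) :
    nat :=
  (\sum_(j < customers_before x i) (arrival_epoch x i < departure c x j)%R)%N.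

Definition mutually_independent d (T : measurableType d) (R : realType)
    (P : probability T R) (I : eqType) (F : I -> set (set T)) : Prop :=
  forall (s : seq I) (E : I -> set T), uniq s ->
    (forall i, i \in s -> F i (E i)) ->
    P (\bigcap_(i in [set` s]) E i) = (\prod_(i <- s) P (E i))%E.

Definition generated_events d d' (T : measurableType d) (T' : measurableType d')
    (f : T -> T') : set (set T) :=
  preimage_set_system setT f measurable.

Record queue_rvs d (T : measurableType d) (R : realType)
    (P : probability T R) := QueueRVs {
  initial_rv : {RV P >-> nat};
  first_arrival_rv : {RV P >-> R};
  gap_rv : nat -> {RV P >-> R};
  batch_size_rv : nat -> {RV P >-> nat};
  service_rv : nat -> {RV P >-> R}
}.

Definition sample d (T : measurableType d) (R : realType) (P : probability T R)
    (Q : queue_rvs P) (w : T) : queue_input R :=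
  QueueInput (initial_rv Q w) (first_arrival_rv Q w) (gap_rv Q ^~ w)
    (batch_size_rv Q ^~ w) (service_rv Q ^~ w).

(* The two components of the initial condition may depend on each other. *)
Definition source_events d (T : measurableType d) (R : realType)
    (P : probability T R) (Q : queue_rvs P) (i : unit + (nat + (nat + nat))) :
    set (set T) :=
  match i with
  | inl _ => generated_events (fun w => (initial_rv Q w, first_arrival_rv Q w))
  | inr (inl k) => generated_events (gap_rv Q k)
  | inr (inr (inl k)) => generated_events (batch_size_rv Q k)
  | inr (inr (inr k)) => generated_events (service_rv Q k)
  end.

(* A is the distribution function of the interarrival times, 1 / lambda their
   mean, b the distribution of the batch sizes, 1 / mu the mean service time.
   The initial number of customers and the first arrival epoch are
   arbitrary. *)
Record is_GIXMc d (T : measurableType d) (R : realType) (P : probability T R)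
    (A : R -> R) (lambda : R) (b : nat -> R) (mu : R) (Q : queue_rvs P) :
    Prop := IsGIXMc {
  first_arrival_ge0 : forall w, 0 <= first_arrival_rv Q w;
  interarrival_ge0 : forall t, t < 0 -> A t = 0;
  gap_cdf : forall i t, cdf (gap_rv Q i) t = (A t)%:E;
  gap_mean : forall i, ('E_P[gap_rv Q i] = (lambda^-1)%:E)%E;
  batch_size_gt0 : b 0%N = 0;
  batch_size_pmf : forall i k, P [set w | batch_size_rv Q i w = k] = (b k)%:E;
  service_exponential : forall j (V : set R), measurable V ->
    distribution P (service_rv Q j) V = exponential_prob mu V;
  sources_independent : mutually_independent P (source_events Q)
}.

Definition batch_mean (R : realType) (b : nat -> R) : \bar R :=
  (\sum_(0 <= k <oo) (k%:R * b k)%:E)%E.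

Definition traffic_intensity (R : realType) (c : nat) (lambda : R)
    (b : nat -> R) (mu : R) : \bar R :=
  (lambda%:E * batch_mean b * ((c%:R * mu)^-1)%:E)%E.

Definition batch_tail (R : realType) (b : nat -> R) (m : nat) : R :=
  limn (fun n => \sum_(m <= i < n) b i).

Definition is_pre_arrival_distribution d (T : measurableType d) (R : realType)
    (P : probability T R) (c : nat) (Q : queue_rvs P) (pi_ : nat -> R) : Prop :=
  (forall k, P [set w | found_by_batch c (sample Q w) i = k] @[i --> \oo]
               --> (pi_ k)%:E) /\
  (\sum_(0 <= k <oo) (pi_ k)%:E = 1)%E.

(* Only the existence of the limits is required here, not that they sum
   to 1. *)
Definition is_time_limit d (T : measurableType d) (R : realType)
    (P : probability T R) (c : nat) (Q : queue_rvs P) (p : nat -> R) : Prop :=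
  forall n, P [set w | (in_system c (sample Q w) t #= `I_n)%card] @[t --> +oo]
              --> (p n)%:E.

(* Main.v *)
Require Import Defs.
From HB Require Import structures.
From mathcomp Require Import all_boot all_order all_algebra.
From mathcomp Require Import finmap.
From mathcomp Require Import all_classical all_reals all_analysis.
From mathcomp Require Import measurable_realfun ring zify lra.

Set Implicit Arguments.
Unset Strict Implicit.
Unset Printing Implicit Defensive.

Import Order.TTheory GRing.Theory Num.Theory.
Import numFieldNormedType.Exports.

Local Open Scope classical_set_scope.
Local Open Scope ring_scope.

(** A level crossing argument. Fix [n >= 1] and look at the crossings of the
    level [n] by the number of customers in the system. Upcrossings occur at
    arrivals: batch [i] makes one when it finds fewer than [n] customers and brings
    enough of them. As the size of a batch is independent of what it finds, the
    probability of this tends to [\sum_(0 <= k < n) pi_ k * batch_tail b (n - k)]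
    ([level_up]). Up- and downcrossings alternate, so a downcrossing between two
    successive arrivals has the same limiting probability ([level_down]).

    Downcrossings are departures that leave [n.-1] customers behind. The
    probability of one between two arrivals is [(minn n c)%:R * mu] times the mean
    time spent there with [n] customers ([cycle_balance]). This holds customer by
    customer: a service time is independent of the epoch where the service
    starts and of how the system evolves until it ends ([nonanticipation]), and
    its hazard rate is the constant [mu] ([exponential_hazard]); when [n] customers
    are present exactly [minn n c] of them are being served ([number_servingE]). In
    this way the residual service times of the other customers never enter.

    It remains to compare averages per arrival with averages over time. By the
    law of large numbers in mean, the [N]-th arrival epoch is [N / lambda] up to
    a negligible error, so the mean time spent with [n] customers per
    interarrival period averages to [p n / lambda] ([time_average]). This gives
    the formula for [n >= 1] ([stationary_level]). For [n = 0] the point is that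
    the [p k] sum to 1: no mass escapes to infinity, because the [pi_ k] sum to 1
    and the interarrival times are uniformly integrable ([sum_sojourn_ge],
    [stationary_zero]). *)

(** * Sample paths *)

Definition service_start (R : realType) (c : nat) (x : queue_input R) j : R :=
  Num.max (customer_arrival x j) (head 0 (free_epochs c x j)).

(** The list of free epochs is studied through the number of its entries beyond
    each epoch: a step of the recursion reorders the list, but acts on this
    count by adding and subtracting an indicator. *)
Definition busy_after (R : realType) (c : nat) (x : queue_input R) j (t : R) :=
  count (fun v => t < v) (free_epochs c x j).

(** What the data of the model satisfy almost surely. *)
Record proper_input (R : realType) (x : queue_input R) : Prop := ProperInput {
  first_arrival_nonneg : 0 <= first_arrival x;
  gap_nonneg : forall i, 0 <= gap x i;
  batch_size_pos : forall i, (0 < batch_size x i)%N;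
  service_pos : forall j, 0 < service x j }.

Definition number_left (R : realType) (c : nat) (x : queue_input R) m (t : R) :=
  (\sum_(j < m) (t < departure c x j)%R)%N.

Definition number_serving (R : realType) (c : nat) (x : queue_input R) m (t : R) :=
  (\sum_(j < m) (service_start c x j <= t < departure c x j)%R)%N.

(** This is [found_by_batch], as an instance of [number_left]. *)
Definition number_found (R : realType) (c : nat) (x : queue_input R) i :=
  number_left c x (customers_before x i) (arrival_epoch x i).

Section FreeEpochs.
Variables (R : realType) (c : nat) (x : queue_input R).
Hypothesis c_gt0 : (0 < c)%N.

Lemma departureE j : departure c x j = service_start c x j + service x j.
Proof. by []. Qed.

Lemma size_free_epochs j : size (free_epochs c x j) = c.
Proof.
elim: j => [|j IHj] /=; first by rewrite size_nseq.
by rewrite size_sort /= size_behead IHj prednK.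
Qed.

Lemma free_epochs_sorted j : sorted <=%R (free_epochs c x j).
Proof.
case: j => [|j] /=; last exact: sort_le_sorted.
by case: c => //= n; elim: n => //= n ->; rewrite lexx.
Qed.

Lemma lt_head_free_epochs j (t : R) :
  (t < head 0 (free_epochs c x j)) = (busy_after c x j t == c).
Proof.
rewrite /busy_after -[X in _ == X](size_free_epochs j) -all_count.
case: (free_epochs c x j) (size_free_epochs j) (free_epochs_sorted j).
  by move=> /= c0; move: c_gt0; rewrite -c0.
move=> v s _ /= s_sorted; apply/idP/andP => [tv|[]//]; split=> //.
apply/allP => u us; apply: lt_le_trans tv _.
by move/order_path_min: s_sorted => /(_ le_trans)/allP; apply.
Qed.

Lemma busy_after_le j (t : R) : (busy_after c x j t <= c)%N.
Proof. by rewrite -[leqRHS](size_free_epochs j) count_size. Qed.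

Lemma busy_afterS j (t : R) :
  (busy_after c x j.+1 t + (t < head 0 (free_epochs c x j))%R =
   busy_after c x j t + (t < departure c x j)%R)%N.
Proof.
rewrite /busy_after /= (permP (permEl (perm_sort _ _))) /= -/(departure c x j).
case: (free_epochs c x j) (size_free_epochs j) => [/= c0|v s _ /=].
  by move: c_gt0; rewrite -c0.
lia.
Qed.

Lemma busy_after0 (t : R) : busy_after c x 0 t = if t < 0 then c else 0%N.
Proof.
by rewrite /busy_after /= count_nseq; case: ifP; rewrite ?mul1n ?mul0n.
Qed.

Lemma lt_service_start j (t : R) :
  (t < service_start c x j) =
  (t < customer_arrival x j) || (busy_after c x j t == c).
Proof. by rewrite lt_max lt_head_free_epochs. Qed.

Lemma number_servingS m (t : R) : number_serving c x m.+1 t =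
  (number_serving c x m t + (service_start c x m <= t < departure c x m)%R)%N.
Proof. by rewrite /number_serving big_ord_recr. Qed.

Hypothesis service_ge0 : forall j, 0 <= service x j.

Lemma service_start_le_departure j : service_start c x j <= departure c x j.
Proof. by rewrite departureE lerDl. Qed.

(** A customer in service keeps busy the server it took, which was free when
    its service started. *)
Lemma number_serving_le_busy_after m (t : R) :
  (number_serving c x m t <= busy_after c x m t)%N.
Proof.
elim: m => [|m IHm]; first by rewrite /number_serving big_ord0.
rewrite number_servingS (leNgt (service_start c x m)).
have := busy_afterS m t; have := service_start_le_departure m.
have : (t < head 0 (free_epochs c x m)) ==> (t < service_start c x m).
  by rewrite lt_max; case: (_ < head _ _); rewrite ?orbT.
case: (ltP t (service_start c x m)) => [h1|h1] + h2.
  rewrite (lt_le_trans h1 h2) /=; case: (t < head _ _) => /=; lia.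
rewrite implybF => /negbTE -> /=; case: (t < departure _ _ _) => /=; lia.
Qed.

Lemma number_serving_eq_busy_after m (t : R) : 0 <= t ->
  (forall j, (j < m)%N -> service_start c x j <= t) ->
  number_serving c x m t = busy_after c x m t.
Proof.
move=> t0; elim: m => [|m IHm] start_le.
  by rewrite /number_serving big_ord0 busy_after0 ltNge t0.
rewrite number_servingS IHm; last first.
  by move=> j jm; apply: start_le; rewrite ltnS ltnW.
have := busy_afterS m t; have start_m := start_le m (ltnSn m).
have /negbTE -> : ~~ (t < head 0 (free_epochs c x m)).
  by rewrite -leNgt (le_trans _ start_m)// le_max lexx orbT.
rewrite start_m /=; case: (t < departure _ _ _) => /=; lia.
Qed.

Lemma number_serving_monotone m m' (t : R) : (m <= m')%N ->
  (number_serving c x m t <= number_serving c x m' t)%N.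
Proof.
move=> mm'; rewrite /number_serving -!(big_mkord xpredT
  (fun j => nat_of_bool (service_start c x j <= t < departure c x j))).
by rewrite (big_cat_nat (leq0n m) mm')/= leq_addr.
Qed.

Lemma number_serving_le_number_left m (t : R) :
  (number_serving c x m t <= number_left c x m t)%N.
Proof. by apply: leq_sum => j _; case: (_ <= t). Qed.

(** Work conservation: no server is idle while a customer waits. The first
    waiting customer sees every server busy, and each of these servers is then
    occupied by an earlier customer that is already in service. *)
Lemma number_servingE m (t : R) : 0 <= t ->
  (forall j, (j < m)%N -> customer_arrival x j <= t) ->
  number_serving c x m t = minn (number_left c x m t) c.
Proof.
move=> t0 arrived.
have serving_le : (number_serving c x m t <= c)%N.
  exact: leq_trans (number_serving_le_busy_after _ _) (busy_after_le _ _).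
have := number_serving_le_number_left m t.
have [[j jm tj]|nowait] := pselect (exists2 j, (j < m)%N & t < service_start c x j).
  case: (ex_minnP (ex_intro (fun j => (j < m)%N && (t < service_start c x j)) j
    (introT andP (conj jm tj)))) => k /andP[km tk] kmin.
  have : number_serving c x k t = c.
    rewrite number_serving_eq_busy_after//; last first.
      move=> l lk; rewrite leNgt; apply/negP => tl.
      by have := kmin l; rewrite (ltn_trans lk km) tl leqNgt lk => /(_ isT).
    apply/eqP; move: tk; rewrite lt_service_start ltNge arrived//=.
  have := number_serving_monotone t (ltnW km); move: serving_le; lia.
suff eq_left : number_serving c x m t = number_left c x m t by lia.
apply: eq_bigr => j _; congr nat_of_bool.
suff -> : service_start c x j <= t by [].
by rewrite leNgt; apply/negP => tj; apply: nowait; exists j.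
Qed.

End FreeEpochs.

Section Epochs.
Variables (R : realType) (c : nat) (x : queue_input R).
Hypotheses (x_proper : proper_input x).

Lemma arrival_epochS i : arrival_epoch x i.+1 = arrival_epoch x i + gap x i.
Proof. by rewrite /arrival_epoch big_ord_recr /= addrA. Qed.

Lemma customers_beforeS i :
  customers_before x i.+1 = (customers_before x i + batch_size x i)%N.
Proof. by rewrite /customers_before big_ord_recr /= addnA. Qed.

Lemma arrival_epoch_monotone i i' : (i <= i')%N ->
  arrival_epoch x i <= arrival_epoch x i'.
Proof.
elim: i' => [|i' IH]; first by rewrite leqn0 => /eqP ->.
rewrite leq_eqVlt => /predU1P[->//|/IH] /le_trans; apply.
by rewrite arrival_epochS lerDl gap_nonneg.
Qed.

Lemma arrival_epoch_ge0 i : 0 <= arrival_epoch x i.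
Proof.
apply: le_trans (arrival_epoch_monotone (leq0n i)).
by rewrite /arrival_epoch big_ord0 addr0 first_arrival_nonneg.
Qed.

Lemma customers_before_monotone i i' : (i <= i')%N ->
  (customers_before x i <= customers_before x i')%N.
Proof.
elim: i' => [|i' IH]; first by rewrite leqn0 => /eqP ->.
rewrite leq_eqVlt => /predU1P[->//|/IH] /leq_trans; apply.
by rewrite customers_beforeS leq_addr.
Qed.

Lemma initial_le_customers_before i : (initial x <= customers_before x i)%N.
Proof. exact: leq_addr. Qed.

Lemma leq_customers_before i : (i <= customers_before x i)%N.
Proof.
elim: i => // i IH; rewrite customers_beforeS.
by have := batch_size_pos x_proper i; lia.
Qed.

Lemma batch_of_lt i j : (initial x <= j < customers_before x i)%N ->
  (batch_of x j < i)%N.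
Proof.
case: i => [|i] /andP[xj ji].
  by move: ji; rewrite /customers_before big_ord0 addn0 ltnNge xj.
rewrite ltnS /batch_of -(big_mkord xpredT
  (fun i => nat_of_bool (customers_before x i.+1 <= j)%N)).
have bound m : (\sum_(0 <= i' < m) (customers_before x i'.+1 <= j)%N <= minn m i)%N.
  elim: m => [|m IHm]; first by rewrite big_geq.
  rewrite big_nat_recr //=.
  case: (leqP i m) => im.
    have := customers_before_monotone (im : (i.+1 <= m.+1)%N).
    by move: ji IHm; case: (leqP (customers_before x m.+1) j) => /=; lia.
  by move: IHm; case: (_ <= j)%N => /=; lia.
by apply: leq_trans (bound j) _; exact: geq_minr.
Qed.

Lemma batch_of_ge i j : (customers_before x i <= j)%N -> (i <= batch_of x j)%N.
Proof.
move=> ij; have i_le_j := leq_trans (leq_customers_before i) ij.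
rewrite /batch_of -(big_mkord xpredT
  (fun i => nat_of_bool (customers_before x i.+1 <= j)%N)).
rewrite (big_cat_nat (leq0n i) i_le_j) /= (_ : \sum_(0 <= i' < i) _ = i)%N ?leq_addr//.
rewrite -[RHS]subn0 -[RHS]muln1 -sum_nat_const_nat; apply: eq_big_nat => i' /andP[_ i'i].
by rewrite (leq_trans _ ij) // customers_before_monotone.
Qed.

Lemma customer_arrival_le i j : (j < customers_before x i.+1)%N ->
  customer_arrival x j <= arrival_epoch x i.
Proof.
move=> ji; rewrite /customer_arrival; case: ltnP => xj.
  exact: arrival_epoch_ge0.
by apply: arrival_epoch_monotone; rewrite -ltnS batch_of_lt// xj.
Qed.

Lemma customer_arrival_ge i j : (customers_before x i <= j)%N ->
  arrival_epoch x i <= customer_arrival x j.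
Proof.
move=> ij; rewrite /customer_arrival ltnNge.
rewrite (leq_trans (initial_le_customers_before i))//=.
exact/arrival_epoch_monotone/batch_of_ge.
Qed.

Lemma customer_arrival_ge0 j : 0 <= customer_arrival x j.
Proof. by rewrite /customer_arrival; case: ifP; rewrite ?arrival_epoch_ge0. Qed.

Lemma in_systemE i s : arrival_epoch x i <= s < arrival_epoch x i.+1 ->
  in_system c x s =
  [set j | (j < customers_before x i.+1)%N && (s < departure c x j)].
Proof.
move=> /andP[lo hi]; apply/seteqP; split => j /=.
  move=> /andP[js sj]; apply/andP; split=> //; rewrite ltnNge; apply/negP => ij.
  by move: hi; rewrite ltNge (le_trans (customer_arrival_ge ij)).
move=> /andP[ji sj]; apply/andP; split=> //.
exact: le_trans (customer_arrival_le ji) lo.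
Qed.

Hypothesis c_gt0 : (0 < c)%N.

(** No member of a batch has left at its arrival epoch, because service times
    are positive. *)
Lemma number_left_after_arrival i :
  number_left c x (customers_before x i.+1) (arrival_epoch x i) =
  (number_found c x i + batch_size x i)%N.
Proof.
rewrite /number_found /number_left customers_beforeS big_split_ord /=.
congr (_ + _)%N; rewrite (eq_bigr (fun=> 1%N)) ?sum1_card ?card_ord// => j _.
rewrite departureE -ltrBlDr (lt_le_trans (y := arrival_epoch x i))//.
  by rewrite ltrBlDr ltrDl service_pos.
rewrite le_max customer_arrival_ge//=; exact: leq_addr.
Qed.
End Epochs.

(** * Ranks, cardinalities and non-anticipation *)

Lemma card_eq_sum (a : nat -> bool) N n :
  ([set j | (j < N)%N && a j] #= `I_n)%card <-> (\sum_(j < N) a j)%N = n.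
Proof.
pose A := seq_fset tt [seq j <- iota 0 N | a j].
have -> : [set j | (j < N)%N && a j] = [set` A].
  apply/seteqP; split => j /=; rewrite seq_fsetE mem_filter mem_iota add0n leq0n;
    by rewrite andbC.
have -> : (\sum_(j < N) a j)%N = #|` A|.
  rewrite size_seq_fset undup_id ?filter_uniq ?iota_uniq//.
  rewrite size_filter -sum1_count -(big_mkord xpredT (fun j => nat_of_bool (a j))).
  by rewrite /index_iota subn0 [RHS]big_mkcond; apply: eq_bigr => j _; case: (a j).
by split=> [/card_eq_fsetP|/card_eq_fsetP].
Qed.

(** This gives access to the number of customers in the system, defined as a
    cardinality, by countable unions and intersections. *)
Lemma card_eq_eventually (a : nat -> bool) n : ([set j | a j] #= `I_n)%card <->
  exists m, forall k, (\sum_(j < m + k) a j)%N = n.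
Proof.
split=> [card_a|[m sum_a]].
  have fin_a : finite_set [set j | a j] by exists n.
  have [m am] : exists m, forall j, a j -> (j < m)%N.
    exists (\max_(j <- fset_set [set j | a j]) j).+1 => j aj; rewrite ltnS.
    apply: (@leq_bigmax_seq _ _ xpredT id) => //.
    by rewrite in_fset_set// inE.
  exists m => k; apply/card_eq_sum; move: card_a; congr (card_eq _ _).
  apply/seteqP; split => j /=; last by case/andP.
  by move=> aj; rewrite aj andbT (leq_trans (am _ aj))// leq_addr.
have : ([set j | (j < m)%N && a j] #= `I_n)%card.
  by apply/card_eq_sum; have := sum_a 0%N; rewrite addn0.
congr (card_eq _ _); apply/seteqP; split => j /=; first by case/andP.
move=> aj; rewrite aj andbT ltnNge; apply/negP => mj.
have := sum_a (j.+1 - m)%N; have := sum_a (j - m)%N.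
rewrite !subnKC ?(leqW mj)// big_ord_recr/= aj; lia.
Qed.

(** Rank the points from the right, starting with 0: the point of rank [n] lies
    beyond [a] exactly when more than [n] points do. Applied to departure epochs,
    this singles out the departure that leaves [n] customers behind. *)
Lemma sum_rank (R : realDomainType) (N n : nat) (d : 'I_N -> R) (a b : R) :
  injective d ->
  (\sum_j ((a < d j <= b)%R && (\sum_l (d j < d l)%R == n)%N))%N =
  ((n < \sum_j (a < d j)%R)%N && (\sum_j (b < d j)%R <= n)%N) :> nat.
Proof.
move=> d_inj.
pose rank j := #|[pred l | d j < d l]|.
have sumE (f : pred 'I_N) : (\sum_j f j)%N = #|[pred j | f j]|.
  rewrite -sum1_card [RHS]big_mkcond /=.
  by apply: eq_bigr => j _; rewrite unfold_in /=; case: (f j).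
have rank_lt j : (rank j < N)%N.
  rewrite -[ltnRHS]card_ord; apply/proper_card/properP; split.
    exact/fintype.subsetP.
  by exists j; rewrite ?inE ?ltxx.
have rank_mono i j : d i < d j -> (rank j < rank i)%N.
  move=> ij; apply/proper_card/properP; split.
    by apply/fintype.subsetP => l; rewrite !inE; exact: lt_trans.
  by exists j; rewrite !inE ?ltxx.
have above j t : (rank j < #|[pred l | (t < d l)%R]|)%N = (t < d j).
  case: (ltP t (d j)) => tj.
    apply/proper_card/properP; split.
      by apply/fintype.subsetP => l; rewrite !inE; exact: lt_trans.
    by exists j; rewrite !inE ?ltxx.
  apply/negbTE; rewrite -leqNgt; apply/subset_leq_card/fintype.subsetP => l.
  by rewrite !inE; exact: le_lt_trans.
under eq_bigr => j _ do rewrite (sumE (fun l => d j < d l)) -/(rank j).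
rewrite (sumE (fun j => a < d j)) (sumE (fun j => b < d j)).
case: (ltnP n N) => nN; last first.
  rewrite big1 => [|j _]; last first.
    by rewrite (ltn_eqF (leq_trans (rank_lt j) nN)) andbF.
  by rewrite ltnNge (leq_trans (max_card _))// card_ord.
pose rk j := Ordinal (rank_lt j).
have rk_inj : injective rk.
  move=> i j /(congr1 val) /= ij; apply: d_inj; apply/eqP.
  rewrite eq_le !leNgt; apply/andP; split; apply/negP => /rank_mono; lia.
have [inv _ rkK] := injF_bij rk_inj.
set j0 := inv (Ordinal nN).
have j0E : rank j0 = n by have := congr1 val (rkK (Ordinal nN)).
rewrite (bigD1 j0)//= big1 ?addn0; last first.
  move=> j /eqP jj0; case: eqP => [jn|]; last by rewrite andbF.
  by case: jj0; apply: rk_inj; apply: val_inj; rewrite /= j0E.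
rewrite j0E eqxx andbT -(above j0 a) j0E; congr (nat_of_bool (_ && _)).
by rewrite leNgt -(above j0 b) j0E -leqNgt.
Qed.

Section ChangeService.
Variables (R : realType) (c : nat).
Implicit Types x y : queue_input R.

Lemma free_epochs_eq x y m :
  (forall j, (j < m)%N -> customer_arrival x j = customer_arrival y j) ->
  (forall j, (j < m)%N -> service x j = service y j) ->
  free_epochs c x m = free_epochs c y m.
Proof.
elim: m => //= m IH arr srv; rewrite IH ?arr ?srv// => j jm.
- by rewrite arr// ltnS ltnW.
- by rewrite srv// ltnS ltnW.
Qed.

Lemma service_start_eq x y m :
  (forall j, (j <= m)%N -> customer_arrival x j = customer_arrival y j) ->
  (forall j, (j < m)%N -> service x j = service y j) ->
  service_start c x m = service_start c y m.
Proof.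
move=> arr srv; rewrite /service_start arr// (@free_epochs_eq x y m)// => j jm.
by rewrite arr// ltnW.
Qed.

Lemma departure_eq x y m :
  (forall j, (j <= m)%N -> customer_arrival x j = customer_arrival y j) ->
  (forall j, (j <= m)%N -> service x j = service y j) ->
  departure c x m = departure c y m.
Proof.
move=> arr srv; rewrite !departureE (service_start_eq arr) ?srv// => j jm.
by rewrite srv// ltnW.
Qed.

Lemma eq_below (s a b : R) : (forall r, r < s -> (r < a) = (r < b)) ->
  a = b \/ (s <= a /\ s <= b).
Proof.
move=> ab; case: (ltgtP a b) => [lab|lba|->]; [right|right|by left].
- suff sa : s <= a by split=> //; exact: le_trans (ltW lab).
  by rewrite leNgt; apply/negP => /ab; rewrite ltxx lab.
- suff sb : s <= b by split=> //; exact: le_trans (ltW lba).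
  by rewrite leNgt; apply/negP => /ab; rewrite ltxx lba.
Qed.

Hypothesis c_gt0 : (0 < c)%N.

(** The service discipline does not anticipate: customer [k] affects the others
    only through the epoch at which it frees its server. As this epoch is at or
    beyond [s] in both inputs, the numbers of free epochs beyond any [r < s]
    agree throughout the recursion. A customer that starts at or beyond [s] leaves
    after [s] in both inputs, because service times are positive. *)
Lemma nonanticipation x y (k : nat) (s : R) :
  customer_arrival x =1 customer_arrival y ->
  (forall j, j != k -> service x j = service y j) ->
  (forall j, 0 < service x j) -> 0 < service y k ->
  s <= departure c x k -> s <= departure c y k ->
  forall j, j != k -> (s < departure c x j) = (s < departure c y j).
Proof.
move=> arr srv Sx Sy xk yk.
have Sy' j : 0 < service y j.
  by have [->//|jk] := eqVneq j k; rewrite -srv.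
have starts j : (forall r, r < s -> busy_after c x j r = busy_after c y j r) ->
    service_start c x j = service_start c y j \/
    (s <= service_start c x j /\ s <= service_start c y j).
  move=> busy; apply: eq_below => r rs.
  by rewrite !lt_service_start// busy// arr.
have busy j r : r < s -> busy_after c x j r = busy_after c y j r.
  elim: j r => [|j IHj] r rs; first by rewrite !busy_after0.
  have dep : (r < departure c x j) = (r < departure c y j).
    have [->|jk] := eqVneq j k; first by rewrite !(lt_le_trans rs).
    rewrite !departureE; case: (starts j IHj) => [->|[sx sy]]; first by rewrite srv.
    rewrite (lt_le_trans rs (le_trans sx _)) ?lerDl ?ltW//.
    by rewrite (lt_le_trans rs (le_trans sy _)) ?lerDl ?ltW.
  have := busy_afterS x c_gt0 j r; have := busy_afterS y c_gt0 j r.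
  rewrite !lt_head_free_epochs// IHj// dep; lia.
move=> j jk; rewrite !departureE; case: (starts j (busy j)) => [->|[sx sy]].
  by rewrite srv.
have lt_of a b : s <= a -> 0 < b -> s < a + b.
  by move=> sa b0; rewrite (le_lt_trans sa)// ltrDl.
by rewrite !lt_of.
Qed.

End ChangeService.

(** * Measurability of the queue *)

Section MeasurableTools.
Context d (T : measurableType d).

Lemma measurable_set_bool (f : T -> bool) : measurable_fun setT f ->
  measurable [set w | f w].
Proof. by move=> /(_ measurableT [set true] I); rewrite setTI. Qed.

Lemma measurable_nat_of_bool (f : T -> bool) : measurable_fun setT f ->
  measurable_fun setT (fun w => nat_of_bool (f w)).
Proof. by move=> mf; apply: (@measurable_comp _ _ _ _ _ _ setT). Qed.

Lemma measurable_random_index d' (U : measurableType d') (f : T -> nat)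
    (g : nat -> T -> U) :
  measurable_fun setT f -> (forall m, measurable_fun setT (g m)) ->
  measurable_fun setT (fun w => g (f w) w).
Proof.
move=> mf mg _ A mA; rewrite setTI.
rewrite (_ : _ @^-1` A = \bigcup_m (f @^-1` [set m] `&` g m @^-1` A)).
  apply: bigcup_measurable => m _; apply: measurableI.
    by rewrite -[X in measurable X]setTI; exact: mf.
  by rewrite -[X in measurable X]setTI; exact: mg.
by apply/seteqP; split => [w Aw|w [m _ [/= -> //]]]; exists (f w).
Qed.

Lemma measurable_sum_nat (a : nat -> T -> nat) m :
  (forall j, measurable_fun setT (a j)) ->
  measurable_fun setT (fun w => \sum_(j < m) a j w)%N.
Proof.
move=> ma; elim: m => [|m IHm].
  by under eq_fun do rewrite big_ord0; exact: measurable_cst.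
by under eq_fun do rewrite big_ord_recr; exact: measurable_fun_addn.
Qed.

Lemma measurable_sum_real (R : realType) (a : nat -> T -> R) m :
  (forall j, measurable_fun setT (a j)) ->
  measurable_fun setT (fun w => \sum_(j < m) a j w).
Proof.
move=> ma; elim: m => [|m IHm].
  by under eq_fun do rewrite big_ord0; exact: measurable_cst.
by under eq_fun do rewrite big_ord_recr; exact: measurable_funD.
Qed.

Lemma measurable_fun_lt_cst (R : realType) (h : T -> R) :
  (forall t, measurable_fun setT (fun w => t < h w)) -> measurable_fun setT h.
Proof.
move=> mh; apply: (measurability _ (RGenOInfty.measurableE R)).
move=> /= _ [_ [t ->] <-]; rewrite setTI preimage_itvoy.
exact/measurable_set_bool/mh.
Qed.

End MeasurableTools.

Section MeasurableInput.
Context d (T : measurableType d) (R : realType).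

Record measurable_input (X : T -> queue_input R) : Prop := MeasurableInput {
  measurable_initial : measurable_fun setT (fun w => initial (X w));
  measurable_first_arrival : measurable_fun setT (fun w => first_arrival (X w));
  measurable_gap : forall i, measurable_fun setT (fun w => gap (X w) i);
  measurable_batch_size :
    forall i, measurable_fun setT (fun w => batch_size (X w) i);
  measurable_service : forall j, measurable_fun setT (fun w => service (X w) j) }.

Variables (c : nat) (X : T -> queue_input R).
Hypotheses (c_gt0 : (0 < c)%N) (mX : measurable_input X).

Lemma measurable_arrival_epoch i :
  measurable_fun setT (fun w => arrival_epoch (X w) i).
Proof.
apply: (@measurable_funD _ _ _ _ (fun w => first_arrival (X w))
  (fun w => \sum_(l < i) gap (X w) l)); first exact: measurable_first_arrival.
apply: (measurable_sum_real (a := fun l w => gap (X w) l)) => l; exact: measurable_gap.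
Qed.

Lemma measurable_customers_before i :
  measurable_fun setT (fun w => customers_before (X w) i).
Proof.
apply: (@measurable_fun_addn _ _ _ (fun w => initial (X w))
  (fun w => \sum_(l < i) batch_size (X w) l)%N); first exact: measurable_initial.
apply: (measurable_sum_nat (a := fun l w => batch_size (X w) l)) => l; exact: measurable_batch_size.
Qed.

Lemma measurable_batch_of j : measurable_fun setT (fun w => batch_of (X w) j).
Proof.
apply: (measurable_sum_nat
  (a := fun i w => nat_of_bool (customers_before (X w) i.+1 <= j)%N)) => i.
apply/measurable_nat_of_bool/measurable_fun_leq => //.
exact: measurable_customers_before.
Qed.

Lemma measurable_customer_arrival j :
  measurable_fun setT (fun w => customer_arrival (X w) j).
Proof.
apply: measurable_fun_ifT => //.
  by apply: measurable_fun_ltn => //; exact: measurable_initial.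
apply: (measurable_random_index (g := fun i w => arrival_epoch (X w) i)).
  exact: measurable_batch_of.
exact: measurable_arrival_epoch.
Qed.

(** Counts and free epochs are handled together: the head of the list exceeds
    [s] exactly when the count beyond [s] is [c], and the next count is obtained
    from this head and the departure epoch it determines. *)
Lemma measurable_busy_after j (t : R) :
  measurable_fun setT (fun w => busy_after c (X w) j t).
Proof.
elim: j t => [|j IHj] t.
  by under eq_fun do rewrite busy_after0; exact: measurable_cst.
have mhead : measurable_fun setT (fun w => head 0 (free_epochs c (X w) j)).
  apply: measurable_fun_lt_cst => s.
  under eq_fun do rewrite lt_head_free_epochs//.
  exact: measurable_fun_eqn.
have mdep : measurable_fun setT (fun w => departure c (X w) j).
  apply: (@measurable_funD _ _ _ _ (fun w => service_start c (X w) j)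
    (fun w => service (X w) j)); last exact: measurable_service.
  by apply: measurable_maxr => //; exact: measurable_customer_arrival.
rewrite (_ : (fun w => _) = fun w =>
  (busy_after c (X w) j t + (t < departure c (X w) j)%R -
   (t < head 0 (free_epochs c (X w) j))%R)%N); last first.
  by apply/funext => w; rewrite -busy_afterS// addnK.
apply: measurable_fun_subn; first apply: measurable_fun_addn => //.
  by apply/measurable_nat_of_bool/measurable_fun_ltr.
by apply/measurable_nat_of_bool/measurable_fun_ltr.
Qed.

Lemma measurable_service_start j :
  measurable_fun setT (fun w => service_start c (X w) j).
Proof.
apply: measurable_maxr; first exact: measurable_customer_arrival.
apply: measurable_fun_lt_cst => s.
under eq_fun do rewrite lt_head_free_epochs//.
by apply: measurable_fun_eqn => //; exact: measurable_busy_after.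
Qed.

Lemma measurable_departure j :
  measurable_fun setT (fun w => departure c (X w) j).
Proof.
apply: (@measurable_funD _ _ _ _ (fun w => service_start c (X w) j)
  (fun w => service (X w) j)); first exact: measurable_service_start.
exact: measurable_service.
Qed.

Variables (N : T -> nat) (t : T -> R).
Hypotheses (mN : measurable_fun setT N) (mt : measurable_fun setT t).

Lemma measurable_lt_departure j :
  measurable_fun setT (fun w => t w < departure c (X w) j).
Proof. by apply: measurable_fun_ltr => //; exact: measurable_departure. Qed.

Lemma measurable_number_left :
  measurable_fun setT (fun w => number_left c (X w) (N w) (t w)).
Proof.
apply: (measurable_random_index
  (g := fun m w => number_left c (X w) m (t w))) => // m.
apply: (measurable_sum_nat
  (a := fun j w => nat_of_bool (t w < departure c (X w) j))) => j.
exact/measurable_nat_of_bool/measurable_lt_departure.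
Qed.

Lemma measurable_number_in_system n :
  measurable [set w | (in_system c (X w) (t w) #= `I_n)%card].
Proof.
pose a j w := customer_arrival (X w) j <= t w < departure c (X w) j.
rewrite (_ : mkset _ =
  \bigcup_m \bigcap_k [set w | (\sum_(j < m + k) a j w)%N == n]); last first.
  apply/seteqP; split => w /=.
    move=> /(card_eq_eventually (a ^~ w))[m sum_a].
    by exists m => // k _ /=; rewrite sum_a.
  move=> [m _ sum_a]; apply/(card_eq_eventually (a ^~ w)).
  by exists m => k; apply/eqP/sum_a.
apply: bigcup_measurable => m _; apply: bigcapT_measurable => k.
apply: measurable_set_bool; apply: measurable_fun_eqn => //.
apply: (measurable_sum_nat (a := fun j w => nat_of_bool (a j w))) => j.
apply/measurable_nat_of_bool/measurable_and; last exact: measurable_lt_departure.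
by apply: measurable_fun_ler => //; exact: measurable_customer_arrival.
Qed.

End MeasurableInput.

Lemma measurable_input_comp d d' (T : measurableType d) (T' : measurableType d')
    (R : realType) (X : T -> queue_input R) (f : T' -> T) :
  measurable_fun setT f -> measurable_input X -> measurable_input (X \o f).
Proof.
move=> mf [m1 m2 m3 m4 m5]; split.
- exact: measurableT_comp m1 mf.
- exact: measurableT_comp m2 mf.
- by move=> i; exact: measurableT_comp (m3 i) mf.
- by move=> i; exact: measurableT_comp (m4 i) mf.
- by move=> i; exact: measurableT_comp (m5 i) mf.
Qed.

(** * The hazard rate of exponential service times *)

Section Freezing.
Context d d1 d2 (T : measurableType d) (T1 : measurableType d1)
  (T2 : measurableType d2) (R : realType) (P : probability T R).
Variables (U : {RV P >-> T1}) (V : {RV P >-> T2}).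
Hypothesis UV_indep : forall A B, measurable A -> measurable B ->
  (P (U @^-1` A `&` V @^-1` B) = P (U @^-1` A) * P (V @^-1` B))%E.

(** The law of a pair of independent variables is the product of their laws,
    so that one of them can be integrated with the other one frozen. *)
Lemma freezing (f : T1 * T2 -> \bar R) : measurable_fun setT f ->
  (forall z, 0 <= f z)%E ->
  (\int[P]_w f (U w, V w) =
   \int[P]_w \int[distribution P V]_y f (U w, y))%E.
Proof.
move=> mf f0.
have mUV : measurable_fun setT (fun w => (U w, V w)).
  by apply: measurable_fun_pair.
pose UV : {RV P >-> (T1 * T2)%type} := mfun_Sub (mem_set mUV).
have UVE w : UV w = (U w, V w) by [].
transitivity (\int[distribution P UV]_z f z)%E.
  by rewrite ge0_integral_distribution.
transitivity (\int[(distribution P U) \x (distribution P V)]_z f z)%E.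
  apply: eq_measure_integral => /= A mA _; apply/esym.
  exact: product_measure_unique.
rewrite fubini_tonelli1// ge0_integral_distribution//.
- exact: measurable_fun_fubini_tonelli_F.
- by move=> y; apply: integral_ge0.
Qed.

End Freezing.

Lemma measurable_shift (R : realType) (b : R) : measurable_fun setT
  (+%R b : measurableTypeR R -> measurableTypeR R).
Proof. by apply: (@measurable_funD _ _ _ _ (cst b) id). Qed.

Lemma lebesgue_measure_shift (R : realType) (b : R) (A : set R) :
  measurable A ->
  pushforward lebesgue_measure
    (+%R b : measurableTypeR R -> measurableTypeR R) A = lebesgue_measure A.
Proof.
move=> mA; apply/esym/lebesgue_measure_unique => //=.
  exact: measurable_shift.
move=> mf _ [[u v]] _ <-.
rewrite /pushforward /= (_ : _ @^-1` _ = `]u - b, v - b]%classic); last first.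
  by apply/seteqP; split => y /=; rewrite !in_itv/= ltrBlDl lerBrDl.
rewrite !lebesgue_measure_itv/= !lte_fin ltrD2r -!EFinD.
by case: ifP => // _; congr (_%:E); lra.
Qed.

Lemma ge0_integral_shift (R : realType) (b : R) (f : R -> \bar R) :
  measurable_fun setT f -> (forall y, 0 <= f y)%E ->
  (\int[lebesgue_measure]_y f (b + y)%R = \int[lebesgue_measure]_s f s)%E.
Proof.
move=> mf f0; transitivity (\int[pushforward lebesgue_measure
    (+%R b : measurableTypeR R -> measurableTypeR R)]_y f y)%E.
  rewrite ge0_integral_pushforward//; exact: measurable_shift.
apply: eq_measure_integral; first exact: measurable_shift.
by move=> ms A mA _; exact: lebesgue_measure_shift.
Qed.

Section Slices.
Context d1 d2 (T1 : measurableType d1) (T2 : measurableType d2) (R : realType).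
Variables (m1 : {sigma_finite_measure set T1 -> \bar R})
  (m2 : {sigma_finite_measure set T2 -> \bar R}).
Variables (A : set (T1 * T2)) (mA : measurable A).

Lemma xsectionE x : xsection A x = [set y | A (x, y)].
Proof. by apply/seteqP; split => y; rewrite /xsection /= in_setE. Qed.

Lemma ysectionE y : ysection A y = [set x | A (x, y)].
Proof. by apply/seteqP; split => x; rewrite /ysection /= in_setE. Qed.

Lemma measurable_xsection_set x : measurable [set y | A (x, y)].
Proof. by rewrite -xsectionE; exact: measurable_xsection. Qed.

Lemma measurable_ysection_set y : measurable [set x | A (x, y)].
Proof. by rewrite -ysectionE; exact: measurable_ysection. Qed.

Lemma measurable_measure_xsection :
  measurable_fun setT (fun x => m2 [set y | A (x, y)]).
Proof.
by under eq_fun do rewrite -xsectionE; exact: measurable_fun_xsection.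
Qed.

Lemma measurable_measure_ysection :
  measurable_fun setT (fun y => m1 [set x | A (x, y)]).
Proof.
by under eq_fun do rewrite -ysectionE; exact: measurable_fun_ysection.
Qed.

Lemma tonelli_sections :
  (\int[m1]_x m2 [set y | A (x, y)] = \int[m2]_y m1 [set x | A (x, y)])%E.
Proof.
under eq_integral do rewrite -xsectionE.
under [RHS]eq_integral do rewrite -ysectionE.
have := @indic_fubini_tonelli _ _ T1 T2 R m1 m2 A mA.
by rewrite indic_fubini_tonelli_FE// indic_fubini_tonelli_GE.
Qed.

End Slices.

Section ExponentialHazard.
Variables (R : realType) (mu : R) (nu : probability R R).
Hypotheses (mu_gt0 : 0 < mu)
  (nuE : forall B, measurable B -> nu B = exponential_prob mu B).

Lemma exponential_survival (x : R) : 0 <= x ->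
  nu `]x, +oo[%classic = (expR (- mu * x))%:E.
Proof.
move=> x0.
have neg : nu `]-oo, 0[%classic = 0%E.
  rewrite nuE// /exponential_prob integral0_eq// => y /=.
  by rewrite in_itv/= => y0; rewrite lt0_exponential_pdf.
have low : nu `[0, x]%classic = (1 - (expR (- mu * x))%:E)%E.
  rewrite nuE//; move: x0; rewrite le_eqVlt => /predU1P[<-|x0].
    rewrite set_itv1 /exponential_prob integral_set1.
    by rewrite mulr0 expR0 -EFinB subrr.
  exact: exponential_prob_itv0c.
have := probability_setC nu (measurable_itv `]-oo, x]).
rewrite setCitvl => ->.
rewrite (_ : `]-oo, x]%classic = `]-oo, 0[ `|` `[0, x]); last first.
  by rewrite -itv_bndbnd_setU//= ?bnd_simp.
rewrite measureU//; last first.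
  apply/seteqP; split => // y /= [].
  by rewrite !in_itv/= => y0 /andP[]; rewrite leNgt y0.
transitivity (1 - (0 + (1 - (expR (- mu * x))%:E)))%E.
  by congr (1 - (_ + _))%E; [exact: neg|exact: low].
by rewrite add0e -!EFinB; congr (_%:E); rewrite opprB addrC subrK.
Qed.

(** The hazard rate of an exponential service time is the constant [mu]. By
    Tonelli, the mean time that a service started at [b] spends in [V] is the
    integral over [V] of the probability that it is still going on, and [mu]
    times this probability is the density of its end. *)
Lemma exponential_hazard (V : set R) (b : R) : measurable V ->
  (nu [set y | V (b + y)%R] =
   mu%:E * \int[nu]_y lebesgue_measure [set s | V s /\ (b <= s < b + y)%R])%E.
Proof.
move=> mV.
have mVb : measurable [set y | V (b + y)].
  by have := measurable_shift b measurableT mV; rewrite setTI.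
pose f (s : R) := ((\1_V s) * exponential_pdf mu (s - b)).
have mf : measurable_fun setT (EFin \o f).
  apply/measurable_EFinP; apply: (@measurable_funM _ _ _ _ (\1_V)) => //.
  apply: (measurableT_comp (measurable_exponential_pdf mu)).
  by apply: (@measurable_funB _ _ _ _ id (cst b)).
have f0 s : (0 <= (f s)%:E)%E.
  by rewrite lee_fin mulr_ge0// exponential_pdf_ge0// ltW.
transitivity (\int[lebesgue_measure]_s (f s)%:E)%E.
  rewrite -(ge0_integral_shift b mf f0) nuE// /exponential_prob integral_mkcond.
  apply: eq_integral => y _; rewrite patchE /f /= indicE.
  rewrite (_ : b + y - b = y); last by rewrite addrAC subrr add0r.
  case: ifPn => yV.
    by rewrite mem_set ?mul1r//; move: yV; rewrite inE.
  by rewrite memNset ?mul0r// => Vy; move: yV; rewrite mem_set.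
pose K := [set ys : R * R | V ys.2 /\ (b <= ys.2 < b + ys.1)%R].
have mK : measurable K.
  apply: (measurableI [set ys : R * R | V ys.2]).
    by have := @measurable_snd _ _ R R measurableT V mV; rewrite setTI.
  apply: measurable_set_bool; apply: measurable_and.
    by apply: measurable_fun_ler.
  apply: measurable_fun_ltr => //.
  by apply: (@measurable_funD _ _ _ _ (cst b) fst).
rewrite (tonelli_sections nu lebesgue_measure mK).
rewrite -ge0_integralZl//; last 2 first.
- exact: measurable_measure_ysection.
- by rewrite lee_fin ltW.
apply: eq_integral => s _; rewrite /f /K /=.
have [Vs|nVs] := pselect (V s); last first.
  rewrite indicE memNset// mul0r (_ : mkset _ = set0) ?measure0 ?mule0//.
  by apply/seteqP; split => y //= [].
rewrite indicE mem_set// mul1r; case: (lerP b s) => bs; last first.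
  rewrite lt0_exponential_pdf ?subr_lt0//.
  rewrite (_ : mkset _ = set0) ?measure0 ?mule0//.
  by apply/seteqP; split => y //= [].
rewrite (_ : mkset _ = `]s - b, +oo[%classic); last first.
  by apply/seteqP; split => y /=; rewrite in_itv/= andbT ltrBlDl => // -[].
rewrite exponential_survival ?subr_ge0//.
by rewrite exponential_pdfE ?subr_ge0.
Qed.

End ExponentialHazard.

(** * Independence of one source from the others *)

Section Hazard.
Context d d1 (T : measurableType d) (T1 : measurableType d1) (R : realType)
  (P : probability T R).
Variables (mu : R) (U : {RV P >-> T1}) (V : {RV P >-> R}).
Hypothesis UV_indep : forall A B, measurable A -> measurable B ->
  (P (U @^-1` A `&` V @^-1` B) = P (U @^-1` A) * P (V @^-1` B))%E.
Hypotheses (mu_gt0 : 0 < mu)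
  (VE : forall B, measurable B -> distribution P V B = exponential_prob mu B).

(** Given [U], the service starts at the known epoch [b U], and [H] becomes a
    fixed set of epochs, so that [exponential_hazard] applies. *)
Lemma hazard_identity (H : set (T1 * R)) (b : T1 -> R) :
  measurable H -> measurable_fun setT b ->
  (P [set w | H (U w, b (U w) + V w)%R] =
   mu%:E * \int[P]_w lebesgue_measure
     [set s | H (U w, s) /\ (b (U w) <= s < b (U w) + V w)%R])%E.
Proof.
move=> mH mb.
pose K := [set zy : T1 * R | H (zy.1, b zy.1 + zy.2)].
have mshift : measurable_fun setT (fun zy : T1 * R => b zy.1 + zy.2).
  apply: (@measurable_funD _ _ _ _ (b \o fst) snd) => //.
  exact: measurableT_comp.
have mK : measurable K.
  have : measurable_fun setT (fun zy : T1 * R => (zy.1, b zy.1 + zy.2)).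
    exact: measurable_fun_pair.
  by move=> /(_ measurableT H mH); rewrite setTI.
pose L := [set zys : (T1 * R) * R |
  H (zys.1.1, zys.2) /\ (b zys.1.1 <= zys.2 < b zys.1.1 + zys.1.2)%R].
have mL : measurable L.
  apply: (measurableI [set zys : (T1 * R) * R | H (zys.1.1, zys.2)]).
    have : measurable_fun setT (fun zys : (T1 * R) * R => (zys.1.1, zys.2)).
      apply: measurable_fun_pair => //.
      exact: (measurableT_comp measurable_fst measurable_fst).
    by move=> /(_ measurableT H mH); rewrite setTI.
  apply: measurable_set_bool; apply: measurable_and.
    apply: measurable_fun_ler => //; apply: (measurableT_comp mb).
    exact: (measurableT_comp measurable_fst measurable_fst).
  apply: measurable_fun_ltr => //.
  exact: (measurableT_comp mshift measurable_fst).
transitivity (\int[P]_w (\1_K (U w, V w))%:E)%E.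
  rewrite (_ : (fun w => _) = (fun w => (\1_[set w | K (U w, V w)] w)%:E)).
    rewrite integral_indic ?setIT//.
    have : measurable_fun setT (fun w => (U w, V w)) by apply: measurable_fun_pair.
    by move=> /(_ measurableT K mK); rewrite setTI.
  by apply/funext => w; rewrite !indicE; congr ((nat_of_bool _)%:R%:E);
    apply/idP/idP; rewrite !in_setE.
rewrite (freezing UV_indep (f := fun z => (\1_K z)%:E)); last 2 first.
- exact/measurable_EFinP.
- by move=> z; rewrite lee_fin.
pose phi (zy : T1 * R) := lebesgue_measure [set s | L (zy, s)].
have mphi : measurable_fun setT phi.
  exact: (measurable_measure_xsection lebesgue_measure mL).
transitivity (\int[P]_w (mu%:E * \int[distribution P V]_y phi (U w, y)))%E.
  apply: eq_integral => w _.
  have mKw := measurable_xsection_set mK (U w).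
  transitivity (distribution P V [set y | K (U w, y)]).
    transitivity (\int[distribution P V]_y (\1_[set y | K (U w, y)] y)%:E)%E.
      by apply: eq_integral => y _; rewrite !indicE; congr ((nat_of_bool _)%:R%:E);
        apply/idP/idP; rewrite !in_setE.
    by rewrite integral_indic ?setIT.
  exact: (exponential_hazard mu_gt0 VE (b (U w)) (measurable_xsection_set mH (U w))).
rewrite ge0_integralZl//; last 3 first.
- apply: (measurableT_comp (f := fun z => \int[distribution P V]_y phi (z, y))%E) => //.
  exact: measurable_fun_fubini_tonelli_F.
- by move=> w _; exact: integral_ge0.
- by rewrite lee_fin ltW.
by congr (_ * _)%E; rewrite -freezing.
Qed.

End Hazard.

Section Independence.
Context d (T : measurableType d) (R : realType) (P : probability T R).
Variables (I : eqType) (F : I -> set (set T)).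
Hypotheses (F_setT : forall i, F i setT) (F_setI : forall i, setI_closed (F i))
  (F_measurable : forall i, F i `<=` measurable)
  (F_indep : mutually_independent P F).

(** These intersections form a pi-system, which is what extends independence of
    [k] from the single families to the sigma-algebra that they generate. *)
Definition other_events (k : I) : set (set T) :=
  [set A | exists (s : seq I) E, [/\ k \notin s, forall i, F i (E i) &
    A = \bigcap_(i in [set` s]) E i]].

Lemma other_events_setI k : setI_closed (other_events k).
Proof.
move=> _ _ [s [E [ks FE ->]]] [t [G [kt FG ->]]].
exists (s ++ t), (fun i => (if i \in s then E i else setT) `&`
  (if i \in t then G i else setT)); split.
- by rewrite mem_cat negb_or ks.
- by move=> i; apply: F_setI; case: ifP.
apply/seteqP; split => w /=.
  by move=> [sE tG] i _; split; case: ifP => // it; [exact: sE|exact: tG].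
move=> st; split=> i /= ii.
  by have := st i; rewrite /= mem_cat ii => /(_ isT)[].
by have := st i; rewrite /= mem_cat ii orbT => /(_ isT)[].
Qed.

Lemma other_events_measurable k : other_events k `<=` measurable.
Proof.
move=> _ [s [E [_ FE ->]]]; apply: fin_bigcap_measurable => // i _.
exact: F_measurable.
Qed.

Lemma sub_other_events k i A : i != k -> F i A -> other_events k A.
Proof.
move=> ik FA; exists [:: i], (fun j => if j == i then A else setT); split.
- by rewrite inE eq_sym.
- by move=> j; case: eqP => // ->.
apply/seteqP; split => w /=.
  by move=> Aw j /=; rewrite inE => /eqP ->; rewrite eqxx.
by move=> /(_ i); rewrite /= inE eqxx; apply.
Qed.

(** Both sides are finite measures in [A]; they agree on a pi-system, hence on
    the sigma-algebra it generates. *)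
Lemma independent_other_events k A B : <<s other_events k >> A -> F k B ->
  P (A `&` B) = (P A * P B)%E.
Proof.
move=> GA FB; have mB := F_measurable FB.
have PB_fin : P B \is a fin_num by exact: fin_num_measure.
have PB0 : 0 <= fine (P B) by exact: fine_ge0.
have mscaleE C : mscale (NngNum PB0) P C = (P C * P B)%E.
  by rewrite -[X in (_ * X)%E](fineK PB_fin) muleC.
pose m1 := mrestr P mB.
pose m2 := mscale (NngNum PB0) P.
suff -> : P (A `&` B) = m2 A by rewrite /m2 mscaleE.
rewrite -[LHS]/(m1 A).
apply: (@g_sigma_algebra_measure_unique _ _ _ (other_events k)
  (@other_events_measurable k) (fun=> setT)) => //.
- by move=> _; exists [::], (fun=> setT); split => //; rewrite set_nil bigcap_set0.
- by rewrite bigcup_const.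
- exact: other_events_setI.
- move=> _ [s [E [ks FE ->]]]; apply: etrans (esym (mscaleE _)); rewrite /m1 /= /mrestr.
  set E' := fun i => if i == k then B else E i.
  have E'E i : i \in s -> E' i = E i.
    by rewrite /E'; case: eqP => // -> ks'; rewrite ks' in ks.
  have indep u : uniq u -> P (\bigcap_(i in [set` u]) E' i) = (\prod_(i <- u) P (E' i))%E.
    by move=> uu; apply: F_indep => // i _; rewrite /E'; case: eqP => // ->.
  pose u := undup s.
  have uE : \bigcap_(i in [set` s]) E i = \bigcap_(i in [set` u]) E' i.
    apply/seteqP; split => w h i /=.
      by rewrite mem_undup => si; rewrite E'E//; exact: h.
    by move=> si; rewrite -E'E//; apply: h; rewrite /= mem_undup.
  rewrite uE (_ : _ `&` B = \bigcap_(i in [set` k :: u]) E' i).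
    rewrite !indep/= ?undup_uniq ?mem_undup ?ks// big_cons muleC.
    by congr (_ * P _)%E; rewrite /E' eqxx.
  apply/seteqP; split => w /=.
    by move=> [h Bw] i /=; rewrite inE => /predU1P[->|/h//]; rewrite /E' eqxx.
  move=> h; split; last by have := h k; rewrite /= inE eqxx /E' eqxx; apply.
  by move=> i /= iu; apply: h; rewrite /= inE iu orbT.
- move=> _; apply: le_lt_trans (ltry 1).
  exact: (probability_le1 P (measurableI _ _ measurableT mB)).
Qed.

End Independence.

(** * Changing one service time *)

Definition set_service (R : realType) (x : queue_input R) (k : nat) (u : R) :=
  QueueInput (initial x) (first_arrival x) (gap x) (batch_size x)
    (fun j => if j == k then u else service x j).

Section SetService.
Variables (R : realType) (c : nat) (x : queue_input R).
Hypotheses (c_gt0 : (0 < c)%N) (x_proper : proper_input x).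

Lemma service_start_set_service k u :
  service_start c (set_service x k u) k = service_start c x k.
Proof. by apply: service_start_eq => // j jk /=; rewrite ltn_eqF. Qed.

Lemma service_start_ge0 k : 0 <= service_start c x k.
Proof. by rewrite le_max customer_arrival_ge0. Qed.

(** As services start at nonnegative epochs, a service time of [`|s| + 1]
    certainly outlasts [s]. *)
Lemma lt_departure_set_service k (s : R) :
  s < departure c (set_service x k (`|s| + 1)) k.
Proof.
rewrite departureE service_start_set_service /= eqxx addrC -addrA.
by rewrite (le_lt_trans (ler_norm s))// ltrDl ltr_pwDl// service_start_ge0.
Qed.

(** Keeping [k] beyond [s] does not affect the other customers, by
    [nonanticipation]; it adds [k] itself if [k] leaves exactly at [s]. *)
Lemma number_left_set_service m k (s : R) : (k < m)%N -> s <= departure c x k ->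
  (number_left c (set_service x k (`|s| + 1)) m s =
   number_left c x m s + (s == departure c x k))%N.
Proof.
move=> km sk; rewrite /number_left (bigD1 (Ordinal km))//=.
rewrite [in RHS](bigD1 (Ordinal km))//= lt_departure_set_service.
under eq_bigr => j jk.
  rewrite -(nonanticipation c_gt0 (x := x) (y := set_service x k (`|s| + 1))
    (k := k) (s := s))//; first over.
  - by move=> l lk /=; rewrite (negbTE lk).
  - exact: service_pos.
  - by rewrite /= eqxx ltr_pwDr.
  - exact: ltW (lt_departure_set_service _ _).
by case: (ltgtP s (departure c x k)) sk => //= _ _; lia.
Qed.

End SetService.

Section InputEvents.
Context d (T : measurableType d) (R : realType) (P : probability T R).

Definition input_events (X : T -> queue_input R) (i : unit + (nat + (nat + nat))) :
    set (set T) :=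
  match i with
  | inl _ => generated_events (fun w => (initial (X w), first_arrival (X w)))
  | inr (inl k) => generated_events (fun w => gap (X w) k)
  | inr (inr (inl k)) => generated_events (fun w => batch_size (X w) k)
  | inr (inr (inr k)) => generated_events (fun w => service (X w) k)
  end.

Lemma generated_eventsP d' (U : measurableType d') (f : T -> U) B :
  measurable B -> generated_events f (f @^-1` B).
Proof. by move=> mB; exists B => //; rewrite setTI. Qed.

Lemma generated_events_setT d' (U : measurableType d') (f : T -> U) :
  generated_events f setT.
Proof. by exists setT => //; rewrite setTI. Qed.

Lemma generated_events_setI d' (U : measurableType d') (f : T -> U) :
  setI_closed (generated_events f).
Proof.
move=> _ _ [A mA <-] [B mB <-]; rewrite !setTI -preimage_setI.
by apply: generated_eventsP; exact: measurableI.
Qed.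

Lemma generated_events_measurable d' (U : measurableType d') (f : T -> U) :
  measurable_fun setT f -> generated_events f `<=` measurable.
Proof. by move=> mf _ [A mA <-]; exact: mf. Qed.

Lemma input_events_setT X i : input_events X i setT.
Proof. by case: i => [[]|[k|[k|k]]]; exact: generated_events_setT. Qed.

Lemma input_events_setI X i : setI_closed (input_events X i).
Proof. by case: i => [[]|[k|[k|k]]]; exact: generated_events_setI. Qed.

Variable X : T -> queue_input R.
Hypothesis mX : measurable_input X.

Lemma input_events_measurable i : input_events X i `<=` measurable.
Proof.
case: i => [[]|[k|[k|k]]]; apply: generated_events_measurable.
- apply: measurable_fun_pair; [exact: measurable_initial|].
  exact: measurable_first_arrival.
- exact: measurable_gap.
- exact: measurable_batch_size.
- exact: measurable_service.
Qed.

(** A function is measurable on this copy of the sample space when it is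
    determined by the sources of randomness other than [k]; it is then independent
    of [k] by [independent_other_events]. *)
Definition apart_from (k : unit + (nat + (nat + nat))) :=
  g_sigma_algebraType (other_events (input_events X) k).

Lemma measurable_apart k : measurable_fun setT (id : T -> apart_from k).
Proof.
move=> _ A mA; rewrite setTI; move: A mA.
by apply: smallest_sub; [exact: sigma_algebra_measurable|];
  exact: (other_events_measurable input_events_measurable).
Qed.

Definition apart_rv k : {RV P >-> apart_from k} :=
  mfun_Sub (mem_set (@measurable_apart k)).

Lemma measurable_source_apart k i d' (U : measurableType d') (f : T -> U) :
  i != k -> (forall B, measurable B -> input_events X i (f @^-1` B)) ->
  measurable_fun setT (f : apart_from k -> U).
Proof.
move=> ik fi _ B mB; rewrite setTI; apply: sub_sigma_algebra.
apply: (@sub_other_events _ _ _ _ (@input_events_setT X) k i _ ik); exact: fi.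
Qed.

Lemma measurable_input_apart k (Y : apart_from k -> queue_input R) :
  (forall w, initial (Y w) = initial (X w)) ->
  (forall w, first_arrival (Y w) = first_arrival (X w)) ->
  inl tt != k ->
  (forall i, measurable_fun setT (fun w : apart_from k => gap (Y w) i)) ->
  (forall i, measurable_fun setT (fun w : apart_from k => batch_size (Y w) i)) ->
  (forall i, measurable_fun setT (fun w : apart_from k => service (Y w) i)) ->
  measurable_input Y.
Proof.
move=> iY fY k0 gY bY sY; split => //.
- under eq_fun do rewrite iY.
  apply: (measurable_source_apart k0) => B mB.
  apply: (generated_eventsP (fun w => (initial (X w), first_arrival (X w)))
    (B := fst @^-1` B)).
  by rewrite -[X in measurable X]setTI; exact: measurable_fst.
- under eq_fun do rewrite fY.
  apply: (measurable_source_apart k0) => B mB.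
  apply: (generated_eventsP (fun w => (initial (X w), first_arrival (X w)))
    (B := snd @^-1` B)).
  by rewrite -[X in measurable X]setTI; exact: measurable_snd.
Qed.

Lemma measurable_gap_apart k i : inr (inl i) != k ->
  measurable_fun setT (fun w : apart_from k => gap (X w) i).
Proof.
by move=> ik; apply: (measurable_source_apart ik) => B mB;
  exact: generated_eventsP.
Qed.

Lemma measurable_batch_size_apart k i : inr (inr (inl i)) != k ->
  measurable_fun setT (fun w : apart_from k => batch_size (X w) i).
Proof.
by move=> ik; apply: (measurable_source_apart ik) => B mB;
  exact: generated_eventsP.
Qed.

Lemma measurable_service_apart k i : inr (inr (inr i)) != k ->
  measurable_fun setT (fun w : apart_from k => service (X w) i).
Proof.
by move=> ik; apply: (measurable_source_apart ik) => B mB;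
  exact: generated_eventsP.
Qed.

End InputEvents.

(** * Balance of level crossings between two arrivals *)

Lemma nneseries_bool (R : realType) (a : nat -> bool) m :
  (forall j, a j -> (j < m)%N) ->
  (\sum_(0 <= j <oo) ((a j)%:R%:E : \bar R) = (\sum_(j < m) a j)%N%:R%:E)%E.
Proof.
move=> am; rewrite (nneseries_split 0 m); last by move=> j _; rewrite lee_fin.
rewrite add0n eseries0 ?adde0; last first.
  by move=> j /= mj _; case: (boolP (a j)) => // /am; rewrite ltnNge mj.
by rewrite big_mkord sumEFin natr_sum.
Qed.

Section CustomerHazard.
Context d (T : measurableType d) (R : realType) (P : probability T R).
Variables (c : nat) (mu : R) (X : T -> queue_input R).
Hypotheses (c_gt0 : (0 < c)%N) (mu_gt0 : 0 < mu).
Hypotheses (X_proper : forall w, proper_input (X w)) (mX : measurable_input X).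
Hypothesis X_indep : mutually_independent P (input_events X).
Hypothesis service_law : forall j B, measurable B ->
  P [set w | B (service (X w) j)] = exponential_prob mu B.

Let src (j : nat) : unit + (nat + (nat + nat)) := inr (inr (inr j)).

Lemma customer_hazard j (H : set (apart_from X (src j) * R))
    (b : apart_from X (src j) -> R) :
  measurable H -> measurable_fun setT b ->
  (P [set w | H (w, b w + service (X w) j)%R] =
   mu%:E * \int[P]_w lebesgue_measure
     [set s | H (w, s) /\ (b w <= s < b w + service (X w) j)%R])%E.
Proof.
move=> mH mb.
pose V : {RV P >-> R} := mfun_Sub (mem_set (measurable_service mX j)).
apply: (@hazard_identity _ _ _ _ _ P mu (apart_rv P mX (src j)) V).
- move=> A B mA mB.
  apply: (independent_other_events (@input_events_setT _ _ _ X)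
    (@input_events_setI _ _ _ X) (input_events_measurable mX) X_indep
    (k := src j)); first exact: mA.
  exact: (generated_eventsP (fun w => service (X w) j) mB).
- exact: mu_gt0.
- by move=> B mB; exact: service_law.
- exact: mH.
- exact: mb.
Qed.

(** Overwriting the service time of [j] removes the only dependence of the input
    on that source. *)
Lemma measurable_set_service j d' (Y : measurableType d')
    (f : Y -> apart_from X (src j)) (u : Y -> R) :
  measurable_fun setT f -> measurable_fun setT u ->
  measurable_input (fun y => set_service (X (f y)) j (u y)).
Proof.
move=> mf mu'.
have mX0 : measurable_input
    (fun w : apart_from X (src j) => set_service (X w) j 0).
  apply: measurable_input_apart => //.
  - by move=> i; exact: measurable_gap_apart.
  - by move=> i; exact: measurable_batch_size_apart.
  - move=> i /=; have [_|ij] := eqVneq i j; first exact: measurable_cst.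
    exact: measurable_service_apart.
have [m1 m2 m3 m4 m5] := measurable_input_comp mf mX0.
split => // i /=; have := m5 i => /=.
by case: (i == j).
Qed.

Lemma measurable_service_start_apart j :
  measurable_fun setT
    (fun w : apart_from X (src j) => service_start c (X w) j).
Proof.
under eq_fun do rewrite -(service_start_set_service c (X _) j 0).
apply: measurable_service_start => //.
apply: (@measurable_set_service j _ (apart_from X (src j)) id (cst 0)).
  exact: measurable_id.
exact: measurable_cst.
Qed.

(** The customer spends no time in the single epoch [zeta w], so that it ends its
    service there with probability zero by [customer_hazard]. *)
Lemma departure_atomless j (zeta : apart_from X (src j) -> R) :
  measurable_fun setT zeta -> P [set w | departure c (X w) j = zeta w] = 0%E.
Proof.
move=> mzeta.
have mH : measurable [set ws : apart_from X (src j) * R | ws.2 = zeta ws.1].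
  rewrite (_ : mkset _ = [set ws | ws.2 == zeta ws.1]); last first.
    by apply/seteqP; split => ws /= /eqP.
  apply: measurable_set_bool; apply: measurable_fun_eqr => //.
  exact: (measurableT_comp mzeta).
have := customer_hazard mH (@measurable_service_start_apart j) => /= ->.
rewrite integral0_eq ?mule0// => w _.
apply/eqP; rewrite -measure_le0 -(lebesgue_measure_set1 (zeta w)).
apply: le_measure; rewrite ?inE//; last by move=> s [->].
rewrite (_ : mkset _ = [set zeta w] `&`
  [set` `[service_start c (X w) j, service_start c (X w) j + service (X w) j[]).
  exact: measurableI.
by apply/seteqP; split => s /=; rewrite in_itv.
Qed.

Lemma measurable_arrival_epoch_apart j i :
  measurable_fun setT
    (fun w : apart_from X (src j) => arrival_epoch (X w) i).
Proof.
apply: (measurable_arrival_epoch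
  (X := fun w : apart_from X (src j) => set_service (X w) j 0)).
by apply: (@measurable_set_service j _ (apart_from X (src j)) id (cst 0));
  [exact: measurable_id|exact: measurable_cst].
Qed.

Lemma measurable_departure_apart j l : (l < j)%N ->
  measurable_fun setT
    (fun w : apart_from X (src j) => departure c (X w) l).
Proof.
move=> lj.
have depE w : departure c (X w) l = departure c (set_service (X w) j 0) l.
  by apply: departure_eq => // k kl /=; rewrite ltn_eqF// (leq_ltn_trans kl).
under eq_fun do rewrite depE.
apply: measurable_departure => //.
by apply: (@measurable_set_service j _ (apart_from X (src j)) id (cst 0));
  [exact: measurable_id|exact: measurable_cst].
Qed.

Definition no_coincidence (w : T) :=
  (forall j l, j != l -> departure c (X w) j <> departure c (X w) l) /\
  (forall j i, departure c (X w) j <> arrival_epoch (X w) i).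

Lemma ae_no_coincidence : {ae P, forall w, no_coincidence w}.
Proof.
have tie l j : (l < j)%N ->
    {ae P, forall w, departure c (X w) j <> departure c (X w) l}.
  move=> lj; exists [set w | departure c (X w) j = departure c (X w) l]; split.
  - rewrite (_ : mkset _ = [set w | departure c (X w) j == departure c (X w) l]).
      by apply/measurable_set_bool/measurable_fun_eqr; exact: measurable_departure.
    by apply/seteqP; split => w h; exact/eqP.
  - exact: (departure_atomless (@measurable_departure_apart _ _ lj)).
  - by move=> w /=; apply: contra_notP.
have epoch j i : {ae P, forall w, departure c (X w) j <> arrival_epoch (X w) i}.
  exists [set w | departure c (X w) j = arrival_epoch (X w) i]; split.
  - rewrite (_ : mkset _ = [set w | departure c (X w) j == arrival_epoch (X w) i]).
      apply/measurable_set_bool/measurable_fun_eqr; first exact: measurable_departure.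
      exact: measurable_arrival_epoch.
    by apply/seteqP; split => w h; exact/eqP.
  - exact: (departure_atomless (@measurable_arrival_epoch_apart j i)).
  - by move=> w /=; apply: contra_notP.
have aeT : {ae P, forall w, forall j l, (l < j)%N ->
    departure c (X w) j <> departure c (X w) l}.
  apply/ae_foralln => j; apply/ae_foralln => l.
  have [lj|] := boolP (l < j)%N; last by move=> _; apply: aeW.
  by apply: filterS (tie l j lj) => w h _.
have aeE : {ae P, forall w, forall j i, departure c (X w) j <> arrival_epoch (X w) i}.
  by apply/ae_foralln => j; apply/ae_foralln => i; exact: epoch.
apply: filterS2 aeT aeE => w h1 h2; split => // j l.
by rewrite neq_ltn => /orP[jl|lj]; [move=> /esym; exact: h1|exact: h1].
Qed.

Section Cycle.
Variables (i n : nat).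

Let N w := customers_before (X w) i.+1.

Definition cycle_slice w : set R :=
  [set s | (arrival_epoch (X w) i <= s < arrival_epoch (X w) i.+1)%R
           && (number_left c (X w) (N w) s == n)].

Let customer_slice j w : set R :=
  [set s | [&& (j < N w)%N, arrival_epoch (X w) i <= s < arrival_epoch (X w) i.+1,
     service_start c (X w) j <= s < departure c (X w) j
     & number_left c (X w) (N w) s == n]].

Let ends_slice j : set T :=
  [set w | [&& (j < N w)%N,
     arrival_epoch (X w) i <= departure c (X w) j < arrival_epoch (X w) i.+1
     & (number_left c (X w) (N w) (departure c (X w) j)).+1 == n]].

(** Until [j] leaves, the number in the system is the same as if [j] never left,
    and that number is determined by the other sources. The set [H] of epochs at
    which it equals [n] is therefore independent of the service time of [j]. *)
Lemma customer_rate j :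
  (P (ends_slice j) = mu%:E * \int[P]_w lebesgue_measure (customer_slice j w))%E.
Proof.
pose Y (ws : apart_from X (src j) * R) := set_service (X ws.1) j (`|ws.2| + 1).
have mY : measurable_input Y.
  apply: measurable_set_service => //.
  apply: (@measurable_funD _ _ _ _ (fun ws : apart_from X (src j) * R => `|ws.2|)
    (cst 1)) => //.
  by apply: (measurableT_comp (@normr_measurable R setT)).
pose H := [set ws : apart_from X (src j) * R |
  [&& (j < customers_before (Y ws) i.+1)%N,
      arrival_epoch (Y ws) i <= ws.2 < arrival_epoch (Y ws) i.+1 &
      number_left c (Y ws) (customers_before (Y ws) i.+1) ws.2 == n]].
have mH : measurable H.
  have mN : measurable_fun setT (fun ws => customers_before (Y ws) i.+1).
    exact: measurable_customers_before.
  apply: measurable_set_bool; apply: measurable_and.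
    exact: measurable_fun_ltn.
  apply: measurable_and; first apply: measurable_and.
  - by apply: measurable_fun_ler => //; exact: measurable_arrival_epoch.
  - by apply: measurable_fun_ltr => //; exact: measurable_arrival_epoch.
  - by apply: measurable_fun_eqn => //; exact: measurable_number_left.
have := customer_hazard mH (@measurable_service_start_apart j).
rewrite (_ : mkset _ = ends_slice j); last first.
  apply/seteqP; split => w; rewrite /H /ends_slice /=.
    move=> /and3P[jN ->]; rewrite [(j < N w)%N]jN.
    by rewrite number_left_set_service// eqxx addn1.
  move=> /and3P[jN -> h]; rewrite [(j < N w)%N]jN.
  by rewrite number_left_set_service// eqxx addn1.
move=> ->; congr (_ * _)%E; apply: eq_integral => w _.
congr (lebesgue_measure _); apply/seteqP; split => s; rewrite /H /customer_slice /=.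
  move=> [/and3P[jN -> h] /andP[-> sd]]; rewrite [(j < N w)%N]jN [s < _]sd /=.
  move: h; rewrite number_left_set_service ?(ltW sd)//.
  by rewrite (lt_eqF sd) addn0.
move=> /and4P[jN -> /andP[-> sd] h]; rewrite [_ < _ + _]sd; split=> //.
rewrite [(j < _)%N]jN /= number_left_set_service ?(ltW sd)//.
by rewrite (lt_eqF sd) addn0.
Qed.

Lemma measurable_ends_slice j : measurable (ends_slice j).
Proof.
have mN : measurable_fun setT N by exact: measurable_customers_before.
have mdep := measurable_departure c_gt0 mX j.
have mT k := measurable_arrival_epoch mX k.
apply: measurable_set_bool; apply: measurable_and.
  exact: measurable_fun_ltn.
apply: measurable_and; first apply: measurable_and.
- exact: measurable_fun_ler.
- exact: measurable_fun_ltr.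
- apply: (@measurable_fun_eqn _ _ _ (fun w => (_).+1)) => //.
  have := measurable_number_left c_gt0 mX mN mdep.
  by move=> /measurable_fun_addn /(_ (measurable_cst 1%N));
    under eq_fun do rewrite addn1.
Qed.

Let measurable_customer_slice j :
  measurable [set ws : T * R | customer_slice j ws.1 ws.2].
Proof.
have mX1 := measurable_input_comp (@measurable_fst _ _ T R) mX.
have mN : measurable_fun setT (fun ws : T * R => N ws.1).
  exact: measurable_customers_before mX1 i.+1.
have mdep := measurable_departure c_gt0 mX1 j.
have mst := measurable_service_start c_gt0 mX1 j.
have mT k := measurable_arrival_epoch mX1 k.
apply: measurable_set_bool; apply: measurable_and.
  exact: measurable_fun_ltn.
apply: measurable_and; last apply: measurable_and.
- by apply: measurable_and; [exact: measurable_fun_ler|exact: measurable_fun_ltr].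
- by apply: measurable_and; [exact: measurable_fun_ler|exact: measurable_fun_ltr].
- by apply: measurable_fun_eqn => //; exact: measurable_number_left.
Qed.

Lemma measurable_cycle_slice : measurable [set ws : T * R | cycle_slice ws.1 ws.2].
Proof.
have mX1 := measurable_input_comp (@measurable_fst _ _ T R) mX.
have mN : measurable_fun setT (fun ws : T * R => N ws.1).
  exact: measurable_customers_before mX1 i.+1.
have mT k := measurable_arrival_epoch mX1 k.
apply: measurable_set_bool; apply: measurable_and.
  by apply: measurable_and; [exact: measurable_fun_ler|exact: measurable_fun_ltr].
by apply: measurable_fun_eqn => //; exact: measurable_number_left.
Qed.

Hypothesis n_gt0 : (0 < n)%N.

Let sum_ends_slice w : no_coincidence w ->
  (\sum_(j < N w) `[< ends_slice j w >])%N =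
  ((n <= number_left c (X w) (N w) (arrival_epoch (X w) i))%N &&
   (number_left c (X w) (N w) (arrival_epoch (X w) i.+1) < n)%N) :> nat.
Proof.
move=> [noties noepoch].
have d_inj : injective (fun j : 'I_(N w) => departure c (X w) j).
  move=> j l /eqP; apply: contraTeq => jl; apply/eqP/noties.
  by apply: contra jl => /eqP/val_inj ->.
have := sum_rank n.-1 (arrival_epoch (X w) i) (arrival_epoch (X w) i.+1) d_inj.
rewrite prednK// -[(_ <= n.-1)%N]ltnS prednK// => <-; apply: eq_bigr => j _.
congr nat_of_bool; apply/asboolP/idP; rewrite /ends_slice /= ltn_ord /=.
  move=> /andP[/andP[le1 lt2] /eqP <-]; rewrite eqxx andbT.
  by rewrite lt_neqAle le1 (ltW lt2) andbT/= andbT eq_sym; apply/eqP/noepoch.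
move=> /andP[/andP[lt1 le2] /eqP num]; apply/andP; split.
  by rewrite (ltW lt1) lt_neqAle le2 andbT; apply/eqP/noepoch.
by rewrite /number_left num prednK.
Qed.

Let sum_customer_slice w s : (\sum_(j < N w) `[< customer_slice j w s >])%N =
  (minn n c * `[< cycle_slice w s >])%N.
Proof.
have [cyc|ncyc] := asboolP (cycle_slice w s); last first.
  rewrite muln0 big1// => j _; case: asboolP => // /and4P[_ h _ h'].
  by case: ncyc; apply/andP.
have /andP[/[dup] /andP[lo hi] window /eqP num] := cyc.
have s0 : 0 <= s by apply: le_trans lo; exact: arrival_epoch_ge0.
rewrite muln1 -{1}num -number_servingE//; last 2 first.
- by move=> j; rewrite ltW// service_pos.
- by move=> j jN; apply: le_trans lo; exact: customer_arrival_le.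
apply: eq_bigr => j _; congr nat_of_bool.
apply/asboolP/idP; rewrite /customer_slice /= ltn_ord/= window num eqxx andbT//.
Qed.

(** Sum [customer_rate] over the customers. On the left, the level [n] is crossed
    downwards by exactly one departure, the one of rank [n.-1] from the right
    among all departure epochs. On the right, each epoch with [n] customers is
    counted once for each of the [minn n c] services in progress. *)
Lemma cycle_balance :
  (P [set w | (n <= number_left c (X w) (N w) (arrival_epoch (X w) i))%N &&
     (number_left c (X w) (N w) (arrival_epoch (X w) i.+1) < n)%N] =
   (mu * (minn n c)%:R)%:E * \int[P]_w lebesgue_measure (cycle_slice w))%E.
Proof.
pose down w := ((n <= number_left c (X w) (N w) (arrival_epoch (X w) i))%N &&
     (number_left c (X w) (N w) (arrival_epoch (X w) i.+1) < n)%N).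
have mN : measurable_fun setT N by exact: measurable_customers_before.
have mleft k : measurable_fun setT
    (fun w => number_left c (X w) (N w) (arrival_epoch (X w) k)).
  by apply: measurable_number_left => //; exact: measurable_arrival_epoch.
have mdown : measurable [set w | down w].
  by apply/measurable_set_bool/measurable_and;
    [exact: measurable_fun_leq|exact: measurable_fun_ltn].
have left_side : (\sum_(0 <= j <oo) P (ends_slice j) = P [set w | down w])%E.
  transitivity (\int[P]_w \sum_(0 <= j <oo) (\1_(ends_slice j) w)%:E)%E.
    rewrite integral_nneseries//.
    - by apply: eq_eseriesr => j _; rewrite integral_indic ?setIT//;
        exact: measurable_ends_slice.
    - by move=> j; exact/measurable_EFinP/measurable_indic/measurable_ends_slice.
  transitivity (\int[P]_w (\1_[set w | down w] w)%:E)%E; last first.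
    by rewrite integral_indic ?setIT.
  apply: ge0_ae_eq_integral => //.
  - apply: ge0_emeasurable_sum => // j _.
    exact/measurable_EFinP/measurable_indic/measurable_ends_slice.
  - exact/measurable_EFinP/measurable_indic.
  - by move=> w _; apply: nneseries_ge0 => j _ _; rewrite lee_fin.
  have := ae_no_coincidence; apply: filterS => w now _.
  rewrite (eq_eseriesr (g := fun j => (`[< ends_slice j w >]%:R)%:E)); last first.
    by move=> j _; rewrite indicE; congr ((nat_of_bool _)%:R%:E);
      apply/idP/asboolP; rewrite in_setE.
  rewrite (@nneseries_bool _ _ (N w)); last by move=> j /asboolP /andP[].
  rewrite sum_ends_slice// indicE; congr ((nat_of_bool _)%:R%:E).
  by apply/idP/idP; rewrite in_setE.
rewrite -[LHS]/(P [set w | down w]) -left_side.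
under eq_eseriesr do rewrite customer_rate.
have mcs j : measurable_fun setT (fun w => lebesgue_measure (customer_slice j w)).
  exact: (measurable_measure_xsection lebesgue_measure (measurable_customer_slice j)).
rewrite nneseriesZl; last by move=> j _; exact: integral_ge0.
rewrite -integral_nneseries//.
rewrite EFinM -muleA; congr (_ * _)%E.
rewrite -ge0_integralZl//; last first.
  exact: (measurable_measure_xsection lebesgue_measure measurable_cycle_slice).
apply: eq_integral => w _.
have mcsw j : measurable (customer_slice j w).
  exact: (measurable_xsection_set (measurable_customer_slice j) w).
have mcyw : measurable (cycle_slice w).
  exact: (measurable_xsection_set measurable_cycle_slice w).
transitivity (\int[lebesgue_measure]_s \sum_(0 <= j <oo) (\1_(customer_slice j w) s)%:E)%E.
  rewrite integral_nneseries//.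
  - apply: eq_eseriesr => j _; rewrite integral_indic ?setIT//.
    exact: mcsw.
  - by move=> j; apply/measurable_EFinP/measurable_indic; exact: mcsw.
transitivity (\int[lebesgue_measure]_s ((minn n c)%:R%:E * (\1_(cycle_slice w) s)%:E))%E.
  apply: eq_integral => s _.
  rewrite (eq_eseriesr (g := fun j => (`[< customer_slice j w s >]%:R)%:E)); last first.
    by move=> j _; rewrite indicE; congr ((nat_of_bool _)%:R%:E);
      apply/idP/asboolP; rewrite in_setE.
  rewrite (@nneseries_bool _ _ (N w)); last by move=> j /asboolP /andP[].
  rewrite sum_customer_slice natrM EFinM indicE; congr (_ * (nat_of_bool _)%:R%:E)%E.
rewrite ge0_integralZl//; last first.
  by apply/measurable_EFinP/measurable_indic; exact: mcyw.
by rewrite integral_indic ?setIT//; exact: mcyw.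
Qed.

End Cycle.
End CustomerHazard.

(** * A law of large numbers in mean *)

Section LawOfLargeNumbers.
Context d (T : measurableType d) (R : realType) (P : probability T R).
Variables (g : nat -> T -> R) (m : R).
Hypotheses (mg : forall l, measurable_fun setT (g l))
  (g_ge0 : forall l w, 0 <= g l w).
Hypothesis g_mean : forall l, (\int[P]_w (g l w)%:E = m%:E)%E.
Hypothesis g_indep : forall l k A B, l != k -> measurable A -> measurable B ->
  (P (g l @^-1` A `&` g k @^-1` B) = P (g l @^-1` A) * P (g k @^-1` B))%E.

Definition excess l (M : R) w := Num.max (g l w - M) 0.

Hypothesis excess_eq : forall l M,
  (\int[P]_w (excess l M w)%:E = \int[P]_w (excess 0 M w)%:E)%E.

Definition mean_excess M := fine (\int[P]_w (excess 0 M w)%:E)%E.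

Lemma measurable_excess l M : measurable_fun setT (excess l M).
Proof.
apply: measurable_maxr; last exact: measurable_cst.
by apply: (@measurable_funB _ _ _ _ (g l) (cst M)).
Qed.

Lemma excess_ge0 l M w : 0 <= excess l M w.
Proof. by rewrite le_max lexx orbT. Qed.

Lemma excess_le l M w : 0 <= M -> excess l M w <= g l w.
Proof. by move=> M0; rewrite ge_max g_ge0 andbT gerBl. Qed.

Lemma mean_excessE l M : 0 <= M ->
  (\int[P]_w (excess l M w)%:E = (mean_excess M)%:E)%E.
Proof.
move=> M0; rewrite excess_eq /mean_excess fineK// ge0_fin_numE.
  apply: le_lt_trans (ltry m); rewrite -(g_mean 0).
  apply: ge0_le_integral => //.
  - by move=> w _; rewrite lee_fin excess_ge0.
  - exact/measurable_EFinP/measurable_excess.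
  - exact/measurable_EFinP.
  - by move=> w _; rewrite lee_fin excess_le.
by apply: integral_ge0 => w _; rewrite lee_fin excess_ge0.
Qed.

Lemma mean_excess_ge0 M : 0 <= mean_excess M.
Proof.
apply: fine_ge0; apply: integral_ge0 => w _.
by rewrite lee_fin excess_ge0.
Qed.

Lemma integrable_gap0 : P.-integrable setT (EFin \o g 0%N).
Proof.
apply/integrableP; split; first exact/measurable_EFinP.
under eq_integral do rewrite /= ger0_norm//.
by rewrite g_mean ltry.
Qed.

Lemma cvg_mean_excess : mean_excess M%:R @[M --> \oo] --> 0.
Proof.
apply: fine_cvg.
rewrite -[X in _ --> X](integral0 P setT).
apply: (@dominated_cvg _ T R P setT measurableT
  (fun (M : nat) w => (excess 0 M%:R w)%:E) (cst 0%E) (fun w => (g 0 w)%:E)).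
- by move=> M; exact/measurable_EFinP/measurable_excess.
- move=> w _; apply: cvg_near_cst; exists (Num.bound (g 0%N w)) => // M /= gM.
  rewrite /excess; congr (_%:E); apply/max_idPr; rewrite subr_le0.
  apply: le_trans (ltW (archi_boundP (g_ge0 0%N w))) _; by rewrite ler_nat.
- by [].
- exact: integrable_gap0.
- by move=> M w _; rewrite gee0_abs lee_fin ?excess_ge0//; exact: excess_le.
Qed.

Section Truncation.
Variable M : R.
Hypothesis M_ge0 : 0 <= M.
Let u := m - mean_excess M.
Let tr l w := Num.min (g l w) M.

Let tr_ge0 l w : 0 <= tr l w.
Proof. by rewrite le_min g_ge0. Qed.

Let tr_le l w : tr l w <= M.
Proof. by rewrite ge_min lexx orbT. Qed.

Let tr_excess l w : tr l w + excess l M w = g l w.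
Proof. by rewrite /tr /excess; case: (leP (g l w) M) => h; case: leP; lra. Qed.

Let measurable_tr l : measurable_fun setT (tr l).
Proof. by apply: measurable_minr => //; exact: measurable_cst. Qed.

Let tr_mean l : (\int[P]_w (tr l w)%:E = u%:E)%E.
Proof.
have : (\int[P]_w (tr l w)%:E + (mean_excess M)%:E = m%:E)%E.
  rewrite -(mean_excessE l M_ge0) -ge0_integralD//.
  - by rewrite -(g_mean l); apply: eq_integral => w _; rewrite -EFinD tr_excess.
  - by move=> w _; rewrite lee_fin.
  - exact/measurable_EFinP.
  - by move=> w _; rewrite lee_fin excess_ge0.
  - exact/measurable_EFinP/measurable_excess.
rewrite /u; case: (\int[P]_w _)%E => //= r.
by rewrite -EFinD => -[<-]; rewrite addrK.
Qed.

Let u_ge0 : 0 <= u.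
Proof.
by rewrite -lee_fin -(tr_mean 0); apply: integral_ge0 => w _; rewrite lee_fin.
Qed.

Let tr_moment l k :
  (\int[P]_w (tr l w * tr k w)%:E <= (u ^+ 2 + (l == k)%:R * M ^+ 2)%:E)%E.
Proof.
have [<-|lk] := eqVneq l k.
  apply: (@le_trans _ _ (\int[P]_w (cst (M ^+ 2)%:E w))%E).
    apply: ge0_le_integral => //.
    - by move=> w _; rewrite lee_fin mulr_ge0 ?normr_ge0.
    - by apply/measurable_EFinP/measurable_funM.
    - by move=> w _; rewrite lee_fin ler_pM.
  rewrite integral_cst// [X in (_ * X)%E](_ : _ = 1%E); last exact: probability_setT.
  by rewrite mule1 lee_fin mul1r lerDr sqr_ge0.
rewrite mul0r addr0.
pose U : {RV P >-> R} := mfun_Sub (mem_set (mg l)).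
pose V : {RV P >-> R} := mfun_Sub (mem_set (mg k)).
have UV A B : measurable A -> measurable B ->
    (P (U @^-1` A `&` V @^-1` B) = P (U @^-1` A) * P (V @^-1` B))%E.
  by move=> mA mB; exact: g_indep.
have minU w : 0 <= Num.min (U w) M := tr_ge0 l w.
have minV w : 0 <= Num.min (V w) M := tr_ge0 k w.
(* [freezing] asks for nonnegative values at all points, hence the norms. *)
pose f' (z : R * R) := (`|Num.min z.1 M| * `|Num.min z.2 M|)%:E.
have mmin : measurable_fun setT (fun y : R => Num.min y M).
  by apply: measurable_minr => //; exact: measurable_cst.
have mabs : measurable_fun setT (fun y : R => `|Num.min y M|).
  by apply: (measurableT_comp (@normr_measurable R setT)).
have mf' : measurable_fun setT f'.
  apply/measurable_EFinP/measurable_funM.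
    exact: (measurableT_comp mabs measurable_fst).
  exact: (measurableT_comp mabs measurable_snd).
have -> : (\int[P]_w (tr l w * tr k w)%:E =
    \int[P]_w \int[distribution P V]_y f' (U w, y))%E.
  apply: etrans (freezing UV mf' _); last first.
    by move=> z; rewrite lee_fin mulr_ge0 ?normr_ge0.
  by apply: eq_integral => w _; rewrite /f' (ger0_norm (minU w)) (ger0_norm (minV w)).
have inner : (\int[distribution P V]_y (`|Num.min y M|%R)%:E = u%:E)%E.
  rewrite ge0_integral_distribution//; last exact/measurable_EFinP.
  rewrite -(tr_mean k); apply: eq_integral => w _ /=.
  by rewrite (ger0_norm (minV w)).
have -> : (\int[P]_w \int[distribution P V]_y f' (U w, y) =
    \int[P]_w ((tr l w)%:E * u%:E))%E.
  apply: eq_integral => w _; rewrite -inner -ge0_integralZl//; last 2 first.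
  - exact/measurable_EFinP.
  - by rewrite lee_fin.
  by apply: eq_integral => y _; rewrite /f' /= (ger0_norm (minU w)) EFinM.
rewrite ge0_integralZr//; last 2 first.
- exact/measurable_EFinP.
- by move=> w _; rewrite lee_fin.
by rewrite tr_mean -EFinM.
Qed.

Let sum_tr N w := \sum_(l < N) tr l w.

Let sum_tr_ge0 N w : 0 <= sum_tr N w.
Proof. exact: sumr_ge0. Qed.

Let measurable_sum_tr N : measurable_fun setT (sum_tr N).
Proof. exact: (measurable_sum_real (a := tr)). Qed.

Let sum_tr_mean N : (\int[P]_w (sum_tr N w)%:E = (N%:R * u)%:E)%E.
Proof.
under eq_integral do rewrite -sumEFin.
rewrite (@ge0_integral_sum _ T R P setT measurableT 'I_N
  (fun l w => (tr l w)%:E)) //; last 2 first.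
- by move=> l; exact/measurable_EFinP.
- by move=> l w _; rewrite lee_fin.
under eq_bigr do rewrite tr_mean.
by rewrite sumEFin sumr_const card_ord mulr_natl.
Qed.

Let sum_tr_moment N :
  (\int[P]_w (sum_tr N w ^+ 2)%:E <= (N%:R * M ^+ 2 + N%:R ^+ 2 * u ^+ 2)%:E)%E.
Proof.
rewrite (_ : (fun w => _) =
  fun w => (\sum_(l < N) \sum_(k < N) (tr l w * tr k w)%:E)%E); last first.
  apply/funext => w; rewrite expr2 /sum_tr mulr_suml -sumEFin.
  by apply: eq_bigr => l _; rewrite mulr_sumr -sumEFin.
have mtr l k : measurable_fun setT (fun w => (tr l w * tr k w)%:E).
  by apply/measurable_EFinP/measurable_funM.
have tr2_ge0 l k w : (0 <= (tr l w * tr k w)%:E)%E by rewrite lee_fin mulr_ge0.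
rewrite (@ge0_integral_sum _ T R P setT measurableT 'I_N
  (fun l w => \sum_(k < N) (tr l w * tr k w)%:E)%E); last 2 first.
- by move=> l; exact: emeasurable_sum.
- by move=> l w _; exact: sume_ge0.
apply: (@le_trans _ _ (\sum_(l < N) \sum_(k < N)
    (u ^+ 2 + (l == k)%:R * M ^+ 2)%:E)%E).
  apply: lee_sum => l _; rewrite (@ge0_integral_sum _ T R P setT measurableT 'I_N
    (fun k w => (tr l w * tr k w)%:E))//.
  by apply: lee_sum => k _; exact: tr_moment.
under eq_bigr do rewrite sumEFin big_split/= sumr_const card_ord -mulr_suml.
rewrite sumEFin lee_fin (eq_bigr (fun=> u ^+ 2 *+ N + M ^+ 2)).
  by rewrite sumr_const card_ord -[_ *+ N]mulr_natl -(mulr_natl _ N); lra.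
move=> l _; rewrite (bigD1 l)//= eqxx big1 ?addr0 ?mul1r// => k.
by rewrite eq_sym => /negbTE ->.
Qed.

Let deviation N w := `|sum_tr N w - N%:R * u|.

Let deviation_moment N :
  (\int[P]_w (deviation N w ^+ 2)%:E <= (N%:R * M ^+ 2)%:E)%E.
Proof.
have mdev : measurable_fun setT (fun w => (deviation N w ^+ 2)%:E).
  apply/measurable_EFinP/measurable_funX.
  apply: (measurableT_comp (@normr_measurable R setT)).
  by apply: (@measurable_funB _ _ _ _ (sum_tr N) (cst _)).
(* The cross term of the square is moved to the other side, so that only
   nonnegative functions are integrated. *)
have : (\int[P]_w (deviation N w ^+ 2)%:E + (2 * (N%:R * u) * (N%:R * u))%:E <=
    (N%:R * M ^+ 2 + N%:R ^+ 2 * u ^+ 2)%:E + (N%:R ^+ 2 * u ^+ 2)%:E)%E.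
  have Nu0 : 0 <= N%:R * u by rewrite mulr_ge0.
  rewrite EFinM -sum_tr_mean -ge0_integralZl//; last 3 first.
  - exact/measurable_EFinP.
  - by move=> w _; rewrite lee_fin.
  - by rewrite lee_fin mulr_ge0.
  rewrite -ge0_integralD//; last 3 first.
  - by move=> w _; rewrite lee_fin sqr_ge0.
  - by move=> w _; rewrite -EFinM lee_fin !mulr_ge0.
  - apply/measurable_EFinP.
    by apply: (@measurable_funM _ _ _ _ (cst (2 * (N%:R * u))) (sum_tr N)).
  rewrite (_ : (fun w => _) =
    fun w => ((sum_tr N w ^+ 2)%:E + (N%:R ^+ 2 * u ^+ 2)%:E)%E); last first.
    apply/funext => w; rewrite -EFinM -!EFinD /deviation real_normK ?num_real//.
    by congr (_%:E); ring.
  rewrite ge0_integralD//; last 3 first.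
  - by move=> w _; rewrite lee_fin sqr_ge0.
  - exact/measurable_EFinP/measurable_funX.
  - by move=> w _; rewrite lee_fin mulr_ge0 ?sqr_ge0.
  apply: leeD; first exact: sum_tr_moment.
  rewrite integral_cst// [X in (_ * X)%E](_ : _ = 1%E) ?mule1//.
  exact: probability_setT.
have : (0 <= \int[P]_w (deviation N w ^+ 2)%:E)%E.
  by apply: integral_ge0 => w _; rewrite lee_fin sqr_ge0.
case: (\int[P]_w _)%E => //= r _.
by rewrite -!EFinD !lee_fin; lra.
Qed.

(** Each gap is split at [M]. The excess enters through its mean, and the
    truncated part through its second moment, because
    [x <= x ^+ 2 / (2 * a) + a / 2]. *)
Lemma mean_deviation_le N (a : R) : 0 < a ->
  (\int[P]_w (`|\sum_(l < N) g l w - N%:R * m|)%:E <=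
   (N%:R * M ^+ 2 / (2 * a) + a / 2 + 2 * N%:R * mean_excess M)%:E)%E.
Proof.
move=> a0.
have mdev : measurable_fun setT (deviation N).
  apply: (measurableT_comp (@normr_measurable R setT)).
  by apply: (@measurable_funB _ _ _ _ (sum_tr N) (cst _)).
pose sum_ex w := \sum_(l < N) excess l M w.
have mex : measurable_fun setT sum_ex.
  by apply: (measurable_sum_real (a := fun l w => excess l M w)) => l;
    exact: measurable_excess.
have ex0 w : 0 <= sum_ex w by apply: sumr_ge0 => l _; exact: excess_ge0.
have int_ex : (\int[P]_w (sum_ex w)%:E = (N%:R * mean_excess M)%:E)%E.
  under eq_integral do rewrite -sumEFin.
  rewrite (@ge0_integral_sum _ T R P setT measurableT 'I_N
    (fun l w => (excess l M w)%:E)) //; last 2 first.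
  - by move=> l; exact/measurable_EFinP/measurable_excess.
  - by move=> l w _; rewrite lee_fin excess_ge0.
  under eq_bigr do rewrite mean_excessE//.
  by rewrite sumEFin sumr_const card_ord mulr_natl.
have k0 : 0 <= (2 * a)^-1 by rewrite invr_ge0 mulr_ge0 ?ltW.
have c0 : 0 <= a / 2 + N%:R * mean_excess M.
  by apply: addr_ge0; [lra|rewrite mulr_ge0 ?mean_excess_ge0].
apply: (@le_trans _ _ (\int[P]_w (((2 * a)^-1)%:E * (deviation N w ^+ 2)%:E +
    ((sum_ex w)%:E + (a / 2 + N%:R * mean_excess M)%:E)))%E).
  apply: ge0_le_integral => //.
  - apply/measurable_EFinP/(measurableT_comp (@normr_measurable R setT)).
    apply: (@measurable_funB _ _ _ _ (fun w => \sum_(l < N) g l w) (cst _)) => //.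
    exact: (measurable_sum_real (a := g)).
  - apply: emeasurable_funD; last exact/emeasurable_funD/measurable_cst/measurable_EFinP.
    apply/measurable_EFinP.
    by apply: (@measurable_funM _ _ _ _ (cst _)) => //; exact: measurable_funX.
  move=> w _; rewrite -EFinM -!EFinD lee_fin.
  have -> : \sum_(l < N) g l w = sum_tr N w + sum_ex w.
    by rewrite -big_split/=; apply: eq_bigr => l _; rewrite tr_excess.
  have -> : N%:R * m = N%:R * u + N%:R * mean_excess M by rewrite /u; ring.
  have h1 : deviation N w <= (2 * a)^-1 * deviation N w ^+ 2 + a / 2.
    have : 0 <= (2 * a)^-1 * (deviation N w - a) ^+ 2 by rewrite mulr_ge0 ?sqr_ge0.
    suff -> : (2 * a)^-1 * (deviation N w - a) ^+ 2 =
      (2 * a)^-1 * deviation N w ^+ 2 + a / 2 - deviation N w by lra.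
    by field; rewrite gt_eqF.
  have h2 := mulr_ge0 (ler0n R N) (mean_excess_ge0 M).
  have h3 := ex0 w.
  have : `|sum_tr N w - N%:R * u + (sum_ex w - N%:R * mean_excess M)| <=
    deviation N w + (sum_ex w + N%:R * mean_excess M).
    apply: le_trans (ler_normD _ _) _; rewrite lerD2l ler_norml; lra.
  rewrite (_ : _ - N%:R * u + _ = sum_tr N w + sum_ex w -
    (N%:R * u + N%:R * mean_excess M)); last by ring.
  lra.
have me : measurable_fun setT (fun w => (sum_ex w)%:E) by exact/measurable_EFinP.
have mdev2 : measurable_fun setT (fun w => (deviation N w ^+ 2)%:E).
  exact/measurable_EFinP/measurable_funX.
rewrite ge0_integralD//; last 4 first.
- by move=> w _; rewrite -EFinM lee_fin mulr_ge0 ?sqr_ge0.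
- apply/measurable_EFinP.
  by apply: (@measurable_funM _ _ _ _ (cst _)) => //; exact: measurable_funX.
- by move=> w _; rewrite -EFinD lee_fin addr_ge0.
- exact: emeasurable_funD.
rewrite ge0_integralD//; last by move=> w _; rewrite lee_fin.
rewrite ge0_integralZl//; last by move=> w _; rewrite lee_fin sqr_ge0.
rewrite int_ex integral_cst// [X in (_ + (_ + _ * X))%E](_ : _ = 1%E) ?mule1//; last first.
  exact: probability_setT.
apply: (@le_trans _ _ (((2 * a)^-1)%:E * (N%:R * M ^+ 2)%:E +
    ((N%:R * mean_excess M)%:E + (a / 2 + N%:R * mean_excess M)%:E))%E).
  by apply: leeD => //; apply: lee_wpmul2l; [rewrite lee_fin|exact: deviation_moment].
rewrite -EFinM -!EFinD lee_fin le_eqVlt; apply/orP; left; apply/eqP.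
by rewrite [_^-1 * _]mulrC; ring.
Qed.

End Truncation.

(** The weak law of large numbers in mean: the truncation level is chosen first,
    to make the mean excess small, and [N] is then taken large enough to make
    the second moment term small. *)
Lemma law_of_large_numbers (eps : R) : 0 < eps -> \forall N \near \oo,
  (\int[P]_w (`|\sum_(l < N) g l w - N%:R * m|)%:E <= (eps * N%:R)%:E)%E.
Proof.
move=> eps0.
have e4 : 0 < eps / 4 by lra.
have [K _ KP] : \forall M \near \oo, mean_excess M%:R <= eps / 4.
  have /cvgrPdist_le := cvg_mean_excess => /(_ _ e4).
  apply: filterS => M; rewrite sub0r normrN; exact/le_trans/ler_norm.
have eK := KP K (leqnn K).
near=> N.
have N0 : 0 < N%:R :> R by rewrite ltr0n; near: N; exact: nbhs_infty_gt.
(* With [a] proportional to [N], the term [a / 2] is of order [eps * N] and the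
   second moment term is bounded. *)
apply: le_trans (mean_deviation_le (ler0n R K) N (mulr_gt0 e4 N0)) _.
rewrite lee_fin.
have h : K%:R ^+ 2 / (2 * (eps / 4)) <= eps / 4 * N%:R.
  rewrite -ler_pdivrMl//; near: N; exact: nbhs_infty_ger.
have -> : N%:R * K%:R ^+ 2 / (2 * (eps / 4 * N%:R)) =
    K%:R ^+ 2 / (2 * (eps / 4)) :> R.
  by field; rewrite !gt_eqF.
have : N%:R * mean_excess K%:R <= N%:R * (eps / 4) by rewrite ler_pM2l.
have : 0 < eps / 4 * N%:R by rewrite mulr_gt0.
lra.
Unshelve. all: by end_near.
Qed.

End LawOfLargeNumbers.

(** * Time averages *)

Section TimeAverage.
Context d (T : measurableType d) (R : realType) (P : probability T R).
Variables (c : nat) (X : T -> queue_input R) (m : R).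
Hypotheses (c_gt0 : (0 < c)%N) (m_gt0 : 0 < m).
Hypotheses (X_proper : forall w, proper_input (X w)) (mX : measurable_input X).
Hypothesis gap_mean_eq : forall l, (\int[P]_w (gap (X w) l)%:E = m%:E)%E.
Hypothesis gap_lln : forall eps : R, 0 < eps -> \forall N \near \oo,
  (\int[P]_w (`|\sum_(l < N) gap (X w) l - N%:R * m|)%:E <= (eps * N%:R)%:E)%E.

Local Notation vol := (P \x @lebesgue_measure R)%E.

Lemma volE (A : set (T * R)) :
  vol A = (\int[P]_w lebesgue_measure [set s | A (w, s)])%E.
Proof. by apply: eq_integral => w _; rewrite /= xsectionE. Qed.

Definition window (i k : nat) : set (T * R) :=
  [set ws | arrival_epoch (X ws.1) i <= ws.2 < arrival_epoch (X ws.1) k].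

Definition horizon (t : R) : set (T * R) := [set ws | 0 <= ws.2 < t].

Definition in_state n : set (T * R) :=
  [set ws | (in_system c (X ws.1) ws.2 #= `I_n)%card].

Definition mean_sojourn i n :=
  fine (\int[P]_w lebesgue_measure (cycle_slice c X i n w))%E.

Let mX1 : measurable_input (fun ws : T * R => X ws.1).
Proof. exact: (measurable_input_comp (@measurable_fst _ _ T R) mX). Qed.

Lemma measurable_window i k : measurable (window i k).
Proof.
apply: measurable_set_bool; apply: measurable_and.
- by apply: measurable_fun_ler => //; exact: measurable_arrival_epoch mX1 _.
- by apply: measurable_fun_ltr => //; exact: measurable_arrival_epoch mX1 _.
Qed.

Lemma measurable_horizon t : measurable (horizon t).
Proof.
apply: measurable_set_bool; apply: measurable_and.
- exact: measurable_fun_ler.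
- exact: measurable_fun_ltr.
Qed.

Lemma measurable_in_state n : measurable (in_state n).
Proof. exact: measurable_number_in_system. Qed.

Lemma lebesgue_measure_itvco (a b : R) :
  lebesgue_measure [set s | a <= s < b] = (Num.max (b - a) 0)%:E.
Proof.
rewrite (_ : mkset _ = `[a, b[%classic); last first.
  by apply/seteqP; split => s /=; rewrite in_itv.
rewrite lebesgue_measure_itv/= lte_fin; case: ltP => ab.
  by rewrite -EFinB; congr (_%:E); apply/esym/max_idPl; lra.
by congr (_%:E); apply/esym/max_idPr; lra.
Qed.

Lemma measurable_itvco (a b : R) : measurable [set s : R | a <= s < b].
Proof.
rewrite (_ : mkset _ = `[a, b[%classic); first exact: measurable_itv.
by apply/seteqP; split => s /=; rewrite in_itv.
Qed.

Lemma vol_window i : vol (window i i.+1) = m%:E.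
Proof.
rewrite volE -(gap_mean_eq i); apply: eq_integral => w _.
rewrite /window /= lebesgue_measure_itvco arrival_epochS.
by congr (_%:E); rewrite [_ + _ - _]addrAC subrr add0r; apply/max_idPl/gap_nonneg.
Qed.

Lemma cycle_sliceE i n :
  window i i.+1 `&` in_state n = [set ws | cycle_slice c X i n ws.1 ws.2].
Proof.
apply/seteqP; split => -[w s]; rewrite /window /in_state /cycle_slice /=.
  move=> [cell]; rewrite (in_systemE c (X_proper w) cell) cell => /card_eq_sum.
  by move=> /eqP.
move=> /andP[cell /eqP h]; split=> //.
by rewrite (in_systemE c (X_proper w) cell); apply/card_eq_sum.
Qed.

Lemma mean_sojournE i n :
  (vol (window i i.+1 `&` in_state n) = (mean_sojourn i n)%:E)%E.
Proof.
have sojournE : (\int[P]_w lebesgue_measure (cycle_slice c X i n w))%E =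
    vol (window i i.+1 `&` in_state n) by rewrite cycle_sliceE volE.
rewrite /mean_sojourn sojournE fineK// ge0_fin_numE.
  apply: le_lt_trans (ltry m); rewrite -(vol_window i).
  apply: le_measure; rewrite ?inE//.
  - by apply: measurableI; [exact: measurable_window|exact: measurable_in_state].
  - exact: measurable_window.
exact: measure_ge0.
Qed.

Lemma windowS k : window 0 k.+1 = window 0 k `|` window k k.+1.
Proof.
apply/seteqP; split => -[w s]; rewrite /window /=.
  by move=> /andP[-> h]; case: (ltP s (arrival_epoch (X w) k)) => hk;
    [left|right; rewrite h].
have h0k := arrival_epoch_monotone (X_proper w) (leq0n k).
have hkk := arrival_epoch_monotone (X_proper w) (leqnSn k).
move=> [/andP[-> h]|/andP[h ->]]; first by rewrite (lt_le_trans h).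
by rewrite (le_trans h0k).
Qed.

Lemma vol_window_in_state N n :
  vol (window 0 N `&` in_state n) = (\sum_(i < N) mean_sojourn i n)%:E.
Proof.
have mF := measurable_in_state n.
elim: N => [|N IHN].
  rewrite big_ord0 (_ : _ `&` _ = set0) ?measure0//.
  apply/seteqP; split => // -[w s] [/= /andP[h1 h2] _].
  by move: h2; rewrite ltNge h1.
rewrite big_ord_recr /= EFinD -IHN -mean_sojournE windowS setIUl.
apply: measureU.
- by apply: measurableI => //; exact: measurable_window.
- by apply: measurableI => //; exact: measurable_window.
apply/seteqP; split => // -[w s] [[/= /andP[_ h1] _] [/= /andP[h2 _] _]].
by move: h1; rewrite ltNge h2.
Qed.

Let deviation N w := `|\sum_(l < N) gap (X w) l - N%:R * m|.
(** The first arrival epoch may have an infinite mean; only its part within the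
    horizon matters. *)
Let early N w := Num.min (first_arrival (X w)) (N%:R * m).

Let measurable_deviation N : measurable_fun setT (deviation N).
Proof.
apply: (measurableT_comp (@normr_measurable R setT)).
apply: (@measurable_funB _ _ _ _ (fun w => \sum_(l < N) gap (X w) l) (cst _)) => //.
by apply: (measurable_sum_real (a := fun l w => gap (X w) l)) => l;
  exact: measurable_gap.
Qed.

Let measurable_early N : measurable_fun setT (early N).
Proof.
by apply: measurable_minr; [exact: measurable_first_arrival|exact: measurable_cst].
Qed.

Let early_ge0 N w : 0 <= early N w.
Proof. by rewrite le_min first_arrival_nonneg// mulr_ge0// ltW. Qed.

(** Mean length of the difference between the interval from the first arrival to
    the [N]-th one after it and the interval of length [N%:R * m] from 0. *)
Let boundary N := (\int[P]_w (deviation N w)%:E + \int[P]_w (early N w)%:E)%E.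

Let boundaryE N : boundary N = (\int[P]_w (deviation N w + early N w)%:E)%E.
Proof.
under [RHS]eq_integral do rewrite EFinD.
rewrite ge0_integralD//.
- by move=> w _; rewrite lee_fin normr_ge0.
- exact/measurable_EFinP.
- by move=> w _; rewrite lee_fin.
- exact/measurable_EFinP.
Qed.

Let vol_le_boundary N (A : set (T * R)) : measurable A ->
  (forall w, (lebesgue_measure [set s | A (w, s)] <=
     (deviation N w + early N w)%:E)%E) -> (vol A <= boundary N)%E.
Proof.
move=> mA Ale; rewrite volE boundaryE; apply: ge0_le_integral => //.
- exact: (measurable_measure_xsection lebesgue_measure mA).
- by apply/measurable_EFinP/measurable_funD.
Qed.

Let arrival_epochE N w :
  arrival_epoch (X w) N = first_arrival (X w) + \sum_(l < N) gap (X w) l.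
Proof. by []. Qed.

Lemma vol_window_minus_horizon N :
  (vol (window 0 N `\` horizon (N%:R * m)) <= boundary N)%E.
Proof.
have mW := measurable_window 0 N; have mV := measurable_horizon (N%:R * m).
apply: vol_le_boundary; first exact: measurableD.
move=> w; apply: (@le_trans _ _ (lebesgue_measure
  [set s : R | Num.max (N%:R * m) (first_arrival (X w)) <= s < arrival_epoch (X w) N])).
  apply: le_measure; rewrite ?inE.
  - exact: (measurable_xsection_set (measurableD mW mV) w).
  - exact: measurable_itvco.
  move=> s [/= /andP[lo ->]]; rewrite andbT => /negP.
  rewrite /arrival_epoch big_ord0 addr0 in lo.
  rewrite (le_trans _ lo) ?first_arrival_nonneg//= -leNgt => hi.
  by rewrite ge_max hi.
rewrite lebesgue_measure_itvco lee_fin ge_max addr_ge0 ?normr_ge0 ?early_ge0// andbT.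
rewrite /early /deviation arrival_epochE.
have := ler_norm (\sum_(l < N) gap (X w) l - N%:R * m).
by case: (leP (first_arrival (X w)) (N%:R * m)); lra.
Qed.

Lemma vol_horizon_minus_window N :
  (vol (horizon (N%:R * m) `\` window 0 N) <= boundary N)%E.
Proof.
have mW := measurable_window 0 N; have mV := measurable_horizon (N%:R * m).
apply: vol_le_boundary; first exact: measurableD.
have mitv := measurable_itvco.
move=> w; apply: (@le_trans _ _ (lebesgue_measure
  ([set s : R | 0 <= s < early N w] `|`
   [set s : R | arrival_epoch (X w) N <= s < N%:R * m]))).
  apply: le_measure; rewrite ?inE.
  - exact: (measurable_xsection_set (measurableD mV mW) w).
  - by apply: measurableU; exact: mitv.
  move=> s [/= /andP[lo hi]] /negP; rewrite /arrival_epoch big_ord0 addr0.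
  rewrite negb_and -ltNge -leNgt => /orP[h|h]; last by right; rewrite /= h.
  by left; rewrite /= lo lt_min h.
apply: (le_trans (measureU2 lebesgue_measure (mitv 0 (early N w))
  (mitv (arrival_epoch (X w) N) (N%:R * m)))).
rewrite /= !lebesgue_measure_itvco -EFinD lee_fin addrC; apply: lerD.
  rewrite ge_max normr_ge0 andbT arrival_epochE /deviation.
  have := first_arrival_nonneg (X_proper w).
  have := ler_norm (- (\sum_(l < N) gap (X w) l - N%:R * m)).
  by rewrite normrN; lra.
by rewrite subr0 ge_max lexx early_ge0.
Qed.

Lemma vol_window_le N n :
  (vol (window 0 N `&` in_state n) <=
   vol (horizon (N%:R * m) `&` in_state n) + boundary N)%E.
Proof.
have mW := measurable_window 0 N; have mV := measurable_horizon (N%:R * m).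
have mF := measurable_in_state n.
apply: le_trans (leeD2l _ (vol_window_minus_horizon N)).
apply: le_trans (measureU2 _ _ _).
- apply: le_measure; rewrite ?inE; [exact: measurableI| |].
    by apply: measurableU; [exact: measurableI|exact: measurableD].
  by move=> ws [W F]; have [V|nV] := pselect (horizon (N%:R * m) ws); [left|right].
- exact: measurableI.
- exact: measurableD.
Qed.

Lemma vol_horizon_le N n :
  (vol (horizon (N%:R * m) `&` in_state n) <=
   vol (window 0 N `&` in_state n) + boundary N)%E.
Proof.
have mW := measurable_window 0 N; have mV := measurable_horizon (N%:R * m).
have mF := measurable_in_state n.
apply: le_trans (leeD2l _ (vol_horizon_minus_window N)).
apply: le_trans (measureU2 _ _ _).
- apply: le_measure; rewrite ?inE; [exact: measurableI| |].
    by apply: measurableU; [exact: measurableI|exact: measurableD].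
  by move=> ws [V F]; have [W|nW] := pselect (window 0 N ws); [left|right].
- exact: measurableI.
- exact: measurableD.
Qed.

Lemma early_negligible (eps : R) : 0 < eps -> \forall N \near \oo,
  (\int[P]_w (early N w)%:E <= (eps * N%:R)%:E)%E.
Proof.
move=> eps0.
pose f (N : nat) w := (N%:R^-1 * early N w)%:E.
have mf N : measurable_fun setT (f N).
  apply/measurable_EFinP.
  by apply: (@measurable_funM _ _ _ _ (cst _) (early N)).
have f0 N w : (0 <= f N w)%E by rewrite lee_fin mulr_ge0// invr_ge0.
have fcvg : (\int[P]_w f N w)%E @[N --> \oo] --> (\int[P]_w cst 0 w)%E.
  apply: (@dominated_cvg _ T R P setT measurableT f (cst 0%E) (cst m%:E)) => //.
  - move=> w _; apply: cvg_EFin; first by near=> N.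
    rewrite (_ : fine \o _ = (fun N : nat => N%:R^-1 * early N w))//.
    have : (N%:R^-1 * first_arrival (X w) : R) @[N --> \oo] --> 0 * first_arrival (X w).
      apply: cvgMr_tmp; apply/gtr0_cvgV0; last exact: cvgr_idn.
      by near=> N; rewrite ltr0n; near: N; exact: nbhs_infty_gt.
    rewrite mul0r => h; apply: (squeeze_cvgr _ (cvg_cst 0) h).
    near=> N; rewrite mulr_ge0 ?invr_ge0//=; apply: ler_wpM2l; rewrite ?invr_ge0//.
    by rewrite ge_min lexx.
  - exact: finite_measure_integrable_cst.
  - move=> N w _; rewrite gee0_abs// lee_fin.
    have [->|N0] := eqVneq N 0%N; first by rewrite invr0 mul0r ltW.
    rewrite ler_pdivrMl ?ltr0n ?lt0n//; by rewrite ge_min lexx orbT.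
move: fcvg; rewrite integral0 => /fine_cvgP[fin_f /cvgrPdist_le/(_ _ eps0) fcvg].
near=> N.
have N0 : 0 < N%:R :> R by rewrite ltr0n; near: N; exact: nbhs_infty_gt.
have fN : (\int[P]_w f N w)%E \is a fin_num by near: N.
have : `|0 - fine (\int[P]_w f N w)%E| <= eps by near: N.
rewrite sub0r normrN ger0_norm ?fine_ge0 ?integral_ge0// => h.
have -> : (\int[P]_w (early N w)%:E = N%:R%:E * \int[P]_w f N w)%E.
  rewrite -ge0_integralZl//; apply: eq_integral => w _.
  by rewrite -EFinM mulrA mulfV ?gt_eqF ?mul1r.
by rewrite -(fineK fN) -EFinM lee_fin mulrC ler_pM2r.
Unshelve. all: by end_near.
Qed.

Lemma boundary_negligible (eps : R) : 0 < eps -> \forall N \near \oo,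
  (boundary N <= (eps * N%:R)%:E)%E.
Proof.
move=> eps0; have e2 : 0 < eps / 2 by lra.
near=> N.
rewrite (_ : eps * N%:R = eps / 2 * N%:R + eps / 2 * N%:R); last by field.
by rewrite EFinD; apply: leeD; near: N; [exact: gap_lln|exact: early_negligible].
Unshelve. all: by end_near.
Qed.

Variables (n : nat) (p : R).
Hypothesis p_lim :
  P [set w | (in_system c (X w) t #= `I_n)%card] @[t --> +oo] --> p%:E.

Let q s := P [set w | (in_system c (X w) s #= `I_n)%card].

Let measurable_q : measurable_fun setT q.
Proof. exact: (measurable_measure_ysection P (measurable_in_state n)). Qed.

Let p_ge0 : 0 <= p.
Proof.
rewrite -lee_fin; apply: (cvge_to_ge p_lim); apply: nearW => s.
exact: measure_ge0.
Qed.

Lemma vol_horizon_in_state t :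
  vol (horizon t `&` in_state n) = (\int[lebesgue_measure]_(s in `[0%R, t[) q s)%E.
Proof.
have mA : measurable (horizon t `&` in_state n).
  by apply: measurableI; [exact: measurable_horizon|exact: measurable_in_state].
rewrite volE (tonelli_sections P lebesgue_measure mA) [RHS]integral_mkcond.
apply: eq_integral => s _; rewrite patchE; case: ifPn.
  rewrite inE /= in_itv/= => h; congr (P _); apply/seteqP; split => w //=.
  by move=> [].
move=> /negP; rewrite inE /= in_itv/= => h; rewrite (_ : mkset _ = set0) ?measure0//.
by apply/seteqP; split => w // -[].
Qed.

(** From some epoch [s0] on the probability of the state is close to its limit,
    and the time before [s0] has a fixed length. *)
Lemma vol_horizon_average (eps : R) : 0 < eps -> \forall N \near \oo,
  (vol (horizon (N%:R * m) `&` in_state n) <= ((p * m + eps) * N%:R)%:E)%E /\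
  (((p * m - eps) * N%:R)%:E <= vol (horizon (N%:R * m) `&` in_state n))%E.
Proof.
have p0 := p_ge0.
move=> eps0; have e0 : 0 < eps / (2 * m) by rewrite divr_gt0// mulr_gt0.
move: p_lim => /fine_cvgP[fin_q /cvgrPdist_le/(_ _ e0) near_p].
have [s1 [_ s1P]] := near_p; pose s0 := Num.max s1 0.
have s0_ge0 : 0 <= s0 by rewrite le_max lexx orbT.
have q_fin s : q s = (fine (q s))%:E.
  rewrite fineK// fin_num_measure//.
  exact: (measurable_ysection_set (measurable_in_state n) s).
have q_ge0 s : 0 <= fine (q s) by apply: fine_ge0; exact: measure_ge0.
have q_le1 s : fine (q s) <= 1.
  rewrite -lee_fin -q_fin probability_le1//.
  exact: (measurable_ysection_set (measurable_in_state n) s).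
have q_near s : s0 < s -> `|p - fine (q s)| <= eps / (2 * m).
  by move=> ss0; apply: s1P; apply: le_lt_trans ss0; rewrite le_max lexx.
have mfq : measurable_fun setT (fun s => fine (q s)).
  exact: (measurableT_comp (@fine_measurable R setT measurableT) measurable_q).
have int_cst (t a : R) : 0 <= t ->
    (\int[lebesgue_measure]_(s in `[0%R, t[) (a%:E) = (a * t)%:E)%E.
  move=> t0; rewrite integral_cst//= lebesgue_measure_itv/= lte_fin.
  case: ltP => [_|t0']; first by rewrite oppr0 adde0.
  by rewrite (_ : t = 0) ?mulr0 ?mule0//; lra.
near=> N.
have N0 : 0 < N%:R :> R by rewrite ltr0n; near: N; exact: nbhs_infty_gt.
set t := N%:R * m.
have t0 : 0 <= t by rewrite mulr_ge0 ?ltW.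
have s0t : s0 * (1 + p) <= eps / 2 * N%:R.
  rewrite -ler_pdivrMl; last by lra.
  by near: N; exact: nbhs_infty_ger.
have s0_le_t : s0 <= t.
  by rewrite /t -ler_pdivrMr//; near: N; exact: nbhs_infty_ger.
have e_t : eps / (2 * m) * t = eps / 2 * N%:R.
  by rewrite /t; field; rewrite gt_eqF.
have mind : measurable_fun setT (\1_(`[0%R, s0]) : R -> R).
  exact: measurable_indic.
have int_ind : (\int[lebesgue_measure]_(s in `[0%R, t[)
    (\1_(`[0%R, s0]) s : R)%:E <= s0%:E)%E.
  rewrite integral_indic//; apply: (@le_trans _ _ (lebesgue_measure `[0%R, s0])).
    by apply: le_measure; rewrite ?inE//; exact: measurableI.
  rewrite lebesgue_measure_itv/= lte_fin; case: ltP => _.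
    by rewrite oppr0 adde0.
  by rewrite lee_fin.
rewrite vol_horizon_in_state; split.
  apply: (@le_trans _ _ (\int[lebesgue_measure]_(s in `[0%R, t[)
    ((p + eps / (2 * m))%:E + (\1_(`[0%R, s0]) s : R)%:E))%E).
    apply: ge0_le_integral => //.
    - exact: measurable_funS measurable_q.
    - by apply: emeasurable_funD => //; apply/measurable_EFinP; exact: measurable_funS mind.
    move=> s /=; rewrite in_itv/= => /andP[s_ge0 _].
    rewrite -[X in (X <= _)%E]/(q s) q_fin -EFinD lee_fin indicE.
    case: (leP s s0) => ss0.
      rewrite mem_set ?mulr1n/=; last by rewrite /= in_itv/= s_ge0.
      by have := q_le1 s; lra.
    by apply: ler_wpDr => //; have := q_near s ss0; rewrite ler_norml; lra.
  rewrite ge0_integralD//; last 2 first.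
  - by move=> s _; rewrite lee_fin; lra.
  - by apply/measurable_EFinP; exact: measurable_funS mind.
  rewrite int_cst//; apply: le_trans (leeD2l _ int_ind) _.
  rewrite -EFinD lee_fin mulrDl e_t /t.
  have : 0 <= s0 * p by rewrite mulr_ge0.
  lra.
have lower : ((p * t)%:E <= \int[lebesgue_measure]_(s in `[0%R, t[) q s +
    (eps / (2 * m) * t + p * s0)%:E)%E.
  apply: (@le_trans _ _ (\int[lebesgue_measure]_(s in `[0%R, t[)
    (q s + ((eps / (2 * m))%:E + p%:E * (\1_(`[0%R, s0]) s : R)%:E)))%E).
    rewrite -int_cst//; apply: ge0_le_integral => //.
    - apply: emeasurable_funD; first exact: measurable_funS measurable_q.
      apply: emeasurable_funD => //; apply: emeasurable_funM => //.
      by apply/measurable_EFinP; exact: measurable_funS mind.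
    move=> s /=; rewrite in_itv/= => /andP[s_ge0 _].
    rewrite q_fin -EFinM -!EFinD lee_fin indicE.
    case: (leP s s0) => ss0.
      rewrite mem_set ?mulr1n/=; last by rewrite /= in_itv/= s_ge0.
      by have := q_ge0 s; lra.
    rewrite addrA; apply: ler_wpDr; first by rewrite mulr_ge0.
    by have := q_near s ss0; rewrite ler_norml; lra.
  rewrite ge0_integralD//; last 3 first.
  - exact: measurable_funS measurable_q.
  - by move=> s _; rewrite -EFinM -EFinD lee_fin (addr_ge0 (ltW e0))// mulr_ge0.
  - apply: emeasurable_funD => //; apply: emeasurable_funM => //.
    by apply/measurable_EFinP; exact: measurable_funS mind.
  apply: leeD2l; rewrite ge0_integralD//; last 3 first.
  - by move=> s _; rewrite lee_fin ltW.
  - by move=> s _; rewrite -EFinM lee_fin mulr_ge0.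
  - by apply: emeasurable_funM => //; apply/measurable_EFinP; exact: measurable_funS mind.
  rewrite int_cst// EFinD; apply: leeD2l.
  rewrite ge0_integralZl//; last by apply/measurable_EFinP; exact: measurable_funS mind.
  by rewrite EFinM; apply: lee_wpmul2l; rewrite ?lee_fin.
have : (0 <= \int[lebesgue_measure]_(s in `[0%R, t[) q s)%E.
  by apply: integral_ge0 => s _; exact: measure_ge0.
move: lower; case: (\int[_]_(_ in _) _)%E => [r| |//].
  by rewrite -EFinD !lee_fin e_t /t => + _; lra.
by move=> _ _; exact: leey.
Unshelve. all: by end_near.
Qed.

(** The mean time spent in the state up to the [N]-th arrival and up to the epoch
    [N%:R * m] differ by at most [boundary N], which is negligible. *)
Lemma time_average :
  N%:R^-1 * \sum_(i < N) mean_sojourn i n @[N --> \oo] --> p * m.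
Proof.
apply/cvgrPdist_le => eps eps0.
have e2 : 0 < eps / 2 by lra.
near=> N.
have N0 : 0 < N%:R :> R by rewrite ltr0n; near: N; exact: nbhs_infty_gt.
have [up low] : (vol (horizon (N%:R * m) `&` in_state n) <= ((p * m + eps / 2) * N%:R)%:E)%E /\
  (((p * m - eps / 2) * N%:R)%:E <= vol (horizon (N%:R * m) `&` in_state n))%E.
  by near: N; exact: vol_horizon_average.
have bd : (boundary N <= (eps / 2 * N%:R)%:E)%E.
  by near: N; exact: boundary_negligible.
have := le_trans (vol_window_le N n) (leeD up bd).
have := le_trans low (le_trans (vol_horizon_le N n) (leeD2l _ bd)).
rewrite vol_window_in_state -!EFinD !lee_fin => h1 h2.
rewrite -(ler_pM2r N0) -[X in `|_| * X](ger0_norm (ltW N0)) -normrM.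
rewrite mulrBl -mulrA [_^-1 * _]mulrC mulrA mulfVK ?gt_eqF//.
by rewrite ler_norml; lra.
Unshelve. all: by end_near.
Qed.

End TimeAverage.

(** * Stationary probabilities *)

Section RealProbability.
Context d (T : measurableType d) (R : realType) (P : probability T R).

Definition prob (A : set T) : R := fine (P A).

Lemma probE A : measurable A -> P A = (prob A)%:E.
Proof. by move=> mA; rewrite fineK// fin_num_measure. Qed.

Lemma probU A B : measurable A -> measurable B -> A `&` B = set0 ->
  prob (A `|` B) = prob A + prob B.
Proof.
move=> mA mB AB; apply: EFin_inj; rewrite EFinD -!probE//; last exact: measurableU.
exact: measureU.
Qed.

Lemma prob_le A B : measurable A -> measurable B -> A `<=` B -> prob A <= prob B.
Proof. by move=> mA mB AB; rewrite -lee_fin -!probE// le_measure ?inE. Qed.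

Lemma probC A : measurable A -> prob (~` A) = 1 - prob A.
Proof.
move=> mA; apply: EFin_inj; rewrite EFinB -!probE//; last exact: measurableC.
exact: probability_setC.
Qed.

Lemma prob_lt (f : T -> nat) n : measurable_fun setT f ->
  prob [set w | (f w < n)%N] = \sum_(k < n) prob [set w | f w = k].
Proof.
move=> mf; have mlt k : measurable [set w | (f w < k)%N].
  exact/measurable_set_bool/measurable_fun_ltn.
have meq k : measurable [set w | f w = k].
  by rewrite -[X in measurable X]setTI; exact: (mf measurableT [set k]).
elim: n => [|n IHn].
  rewrite big_ord0 (_ : mkset _ = set0) /prob ?measure0//.
  by apply/seteqP; split => w.
rewrite big_ord_recr/= -IHn -probU//.
  congr prob; apply/seteqP; split => w /=.
    by rewrite ltnS leq_eqVlt => /predU1P[->|]; [right|left].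
  by move=> [/ltnW|->]; rewrite ltnS.
by apply/seteqP; split => w //= [+ fn]; rewrite fn ltnn.
Qed.

Lemma prob_ge (f : T -> nat) n : measurable_fun setT f ->
  prob [set w | (n <= f w)%N] = 1 - \sum_(k < n) prob [set w | f w = k].
Proof.
move=> mf; rewrite -prob_lt// -probC; last first.
  exact/measurable_set_bool/measurable_fun_ltn.
congr prob; apply/seteqP; split => w /=; rewrite (leqNgt n); first by move/negP.
by move=> h; apply/negP.
Qed.

End RealProbability.

Lemma cvg_mean (R : realType) (u : nat -> R) (l : R) : u n @[n --> \oo] --> l ->
  N%:R^-1 * \sum_(i < N) u i @[N --> \oo] --> l.
Proof.
move=> /cesaro; rewrite /arithmetic_mean => h; rewrite -cvg_shiftS.
by apply: cvg_trans h; apply: near_eq_cvg; apply: nearW => N /=;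
  rewrite seriesEnat /= big_mkord.
Qed.

Lemma cvg_sum_nat (R : realType) (u : nat -> nat -> R) (l : nat -> R) n :
  (forall k, u k i @[i --> \oo] --> l k) ->
  \sum_(k < n) u k i @[i --> \oo] --> \sum_(k < n) l k.
Proof.
move=> ul; elim: n => [|n IHn].
  by rewrite big_ord0; under eq_fun do rewrite big_ord0; exact: cvg_cst.
by rewrite big_ord_recr; under eq_fun do rewrite big_ord_recr; exact: cvgD.
Qed.

Section BatchFree.
Variables (R : realType) (c : nat).

Definition set_batch (x : queue_input R) (i u : nat) :=
  QueueInput (initial x) (first_arrival x) (gap x)
    (fun j => if j == i then u else batch_size x j) (service x).

Lemma customers_before_set_batch x i u k : (k <= i)%N ->
  customers_before (set_batch x i u) k = customers_before x k.
Proof.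
move=> ki; congr (_ + _)%N; apply: eq_bigr => l _ /=.
by rewrite ltn_eqF// (leq_trans (ltn_ord l)).
Qed.

Lemma batch_of_set_batch x i u j : (j < customers_before x i)%N ->
  batch_of (set_batch x i u) j = batch_of x j.
Proof.
move=> ji; apply: eq_bigr => k _; congr nat_of_bool.
case: (ltnP k i) => ki; first by rewrite customers_before_set_batch.
have i_le y : (customers_before y i <= customers_before y k.+1)%N.
  by rewrite customers_before_monotone// leqW.
have gtj y : (j < customers_before y i)%N -> (customers_before y k.+1 <= j)%N = false.
  by move=> yj; apply/negbTE; rewrite -ltnNge (leq_trans yj).
by rewrite !gtj// customers_before_set_batch.
Qed.

(** Batch [i] arrives after all customers numbered below [customers_before x i],
    which are served in order of arrival. *)
Lemma number_found_set_batch x i u :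
  number_found c (set_batch x i u) i = number_found c x i.
Proof.
rewrite /number_found customers_before_set_batch//; apply: eq_bigr => j _.
congr (nat_of_bool (_ < _)); apply: departure_eq => // k kj.
rewrite /customer_arrival /=; case: ifP => // _.
by rewrite batch_of_set_batch// (leq_ltn_trans kj).
Qed.

End BatchFree.

Section Stationary.
Context d (T : measurableType d) (R : realType) (P : probability T R).
Variables (c : nat) (A : R -> R) (m mu : R) (b : nat -> R) (X : T -> queue_input R).
Variables (pi_ p : nat -> R).
Hypotheses (c_gt0 : (0 < c)%N) (m_gt0 : 0 < m) (mu_gt0 : 0 < mu).
Hypotheses (X_proper : forall w, proper_input (X w)) (mX : measurable_input X).
Hypothesis X_indep : mutually_independent P (input_events X).
Hypothesis service_law : forall j B, measurable B ->
  P [set w | B (service (X w) j)] = exponential_prob mu B.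
Hypothesis gap_mean_eq : forall l, (\int[P]_w (gap (X w) l)%:E = m%:E)%E.
Hypothesis gap_law : forall l t, P [set w | gap (X w) l <= t] = (A t)%:E.
Hypothesis batch_law : forall i k, P [set w | batch_size (X w) i = k] = (b k)%:E.
Hypothesis found_lim : forall k,
  P [set w | number_found c (X w) i = k] @[i --> \oo] --> (pi_ k)%:E.
Hypothesis pi_sum : (\sum_(0 <= k <oo) (pi_ k)%:E = 1)%E.
Hypothesis time_lim : forall n,
  P [set w | (in_system c (X w) t #= `I_n)%card] @[t --> +oo] --> (p n)%:E.

Let Y i w := number_found c (X w) i.

Let mY i : measurable_fun setT (Y i).
Proof.
apply: measurable_number_left => //; first exact: measurable_customers_before.
exact: measurable_arrival_epoch.
Qed.

Let meqY i k : measurable [set w | Y i w = k].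
Proof. by rewrite -[X in measurable X]setTI; exact: (@mY i measurableT [set k] I). Qed.

Let mB i : measurable_fun setT (fun w => batch_size (X w) i).
Proof. exact: measurable_batch_size. Qed.

Let mgeB i k : measurable [set w | (k <= batch_size (X w) i)%N].
Proof. exact/measurable_set_bool/measurable_fun_leq. Qed.

Let y i k := prob P [set w | Y i w = k].

Lemma batch_tailE i k : P [set w | (k <= batch_size (X w) i)%N] = (batch_tail b k)%:E.
Proof.
pose F n := [set w | (k <= batch_size (X w) i < k + n)%N].
have mF n : measurable (F n).
  by apply/measurable_set_bool/measurable_and;
    [exact: measurable_fun_leq|exact: measurable_fun_ltn].
have UF : \bigcup_n F n = [set w | (k <= batch_size (X w) i)%N].
  apply/seteqP; split => w; first by move=> [n _] /andP[].
  move=> /= kB; exists (batch_size (X w) i).+1 => //=.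
  by rewrite /F /= kB /= addnS ltnS leq_addl.
have PF n : P (F n) = (\sum_(k <= j < k + n) b j)%:E.
  elim: n => [|n IHn].
    rewrite addn0 big_geq// (_ : F 0%N = set0) ?measure0//.
    apply/seteqP; split => w //; rewrite /F /= addn0 => /andP[h1 h2].
    by move: h2; rewrite ltnNge h1.
  rewrite addnS big_nat_recr ?leq_addr//= EFinD -IHn -(batch_law i).
  rewrite -measureU//.
  - congr (P _); apply/seteqP; split => w; rewrite /F /=.
      rewrite addnS ltnS => /andP[-> ]; rewrite leq_eqVlt => /predU1P[->|->].
        by right.
      by left.
    by rewrite addnS ltnS => -[/andP[-> /ltnW ->]|->]; rewrite ?leq_addr ?leqnn.
  - by rewrite -[X in measurable X]setTI; exact: (@mB i measurableT [set (k + n)%N] I).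
  - apply/seteqP; split => w //; rewrite /F /= => -[/andP[_ + ] e].
    by rewrite e ltnn.
have := nondecreasing_cvg_mu (mu := P) mF _ _; rewrite UF.
move=> /(_ (mgeB _ _)) PF_cvg.
have {}PF_cvg : (\sum_(k <= j < k + n) b j)%:E @[n --> \oo] -->
    P [set w | (k <= batch_size (X w) i)%N].
  rewrite (_ : (fun n => _) = P \o F); last by apply/funext => n /=; rewrite PF.
  apply: PF_cvg => n n' nn'; apply/subsetPset => w; rewrite /F /= => /andP[-> h].
  by rewrite (leq_trans h)// leq_add2l.
rewrite probE// in PF_cvg *; congr (_%:E).
have {}PF_cvg : \sum_(k <= j < k + n) b j @[n --> \oo] -->
    prob P [set w | (k <= batch_size (X w) i)%N].
  by move/fine_cvgP: PF_cvg => [_].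
apply/esym/cvg_lim => //; rewrite -(cvg_shiftn k).
by under eq_fun do rewrite addnC.
Qed.

Let batch_tail_prob i k :
  prob P [set w | (k <= batch_size (X w) i)%N] = batch_tail b k.
Proof. by rewrite /prob batch_tailE. Qed.

(** The number found by batch [i] is unchanged when the size of this batch is
    overwritten, hence it is determined by the other sources. *)
Lemma found_indep i k j :
  prob P [set w | Y i w = k /\ (j <= batch_size (X w) i)%N] = y i k * batch_tail b j.
Proof.
pose s : unit + (nat + (nat + nat)) := inr (inr (inl i)).
have mXs : measurable_input (fun w : apart_from X s => set_batch (X w) i 0).
  apply: measurable_input_apart => //.
  - by move=> l; exact: measurable_gap_apart.
  - move=> l /=; have [_|li] := eqVneq l i; first exact: measurable_cst.
    exact: measurable_batch_size_apart.
  - by move=> l; exact: measurable_service_apart.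
have mYs : measurable_fun setT (fun w : apart_from X s => Y i w).
  rewrite (_ : (fun w => _) =
    fun w : apart_from X s => number_found c (set_batch (X w) i 0) i); last first.
    by apply/funext => w; rewrite number_found_set_batch.
  apply: measurable_number_left => //; first exact: measurable_customers_before.
  exact: measurable_arrival_epoch.
have GY : <<s other_events (input_events X) s >> [set w | Y i w = k].
  by have := mYs measurableT [set k] I; rewrite setTI.
have := independent_other_events (@input_events_setT _ _ _ X)
  (@input_events_setI _ _ _ X) (input_events_measurable mX) X_indep GY
  (generated_eventsP (fun w => batch_size (X w) i) (B := [set l | (j <= l)%N]) I).
rewrite -(batch_tail_prob i) /y /prob => ->; rewrite fineM//;
  apply: fin_num_measure; [exact: meqY|exact: mgeB].
Qed.

Let Z i w := number_left c (X w) (customers_before (X w) i.+1) (arrival_epoch (X w) i).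

Let ZE i w : Z i w = (Y i w + batch_size (X w) i)%N.
Proof. exact: number_left_after_arrival. Qed.

Let mZ i : measurable_fun setT (Z i).
Proof.
apply: measurable_number_left => //; first exact: measurable_customers_before.
exact: measurable_arrival_epoch.
Qed.

Let level_up i n : prob P [set w | (Y i w < n <= Z i w)%N] =
  \sum_(k < n) y i k * batch_tail b (n - k)%N.
Proof.
suff step k : (k <= n)%N -> prob P [set w | (Y i w < k)%N /\ (n <= Z i w)%N] =
    \sum_(l < k) y i l * batch_tail b (n - l)%N.
  rewrite -step//; congr prob.
  by apply/seteqP; split => w /= => [/andP[]//|[-> ->]].
elim: k => [_|k IHk kn].
  rewrite big_ord0 (_ : mkset _ = set0) /prob ?measure0//.
  by apply/seteqP; split => w // -[].
have mgeZ : measurable [set w | (n <= Z i w)%N].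
  exact/measurable_set_bool/measurable_fun_leq.
have mltY l : measurable [set w | (Y i w < l)%N].
  exact/measurable_set_bool/measurable_fun_ltn.
rewrite big_ord_recr/= -IHk ?(ltnW kn)// -(found_indep i) -probU//.
- congr prob; apply/seteqP; split => w /=.
    move=> [+ nZ]; rewrite ltnS leq_eqVlt => /predU1P[Yk|]; last by left.
    by right; split=> //; move: nZ; rewrite ZE Yk; lia.
  move=> [[h ->]|[Yk h]]; first by rewrite ltnW.
  by rewrite ZE Yk ltnSn; split=> //; lia.
- by apply: measurableI; [exact: mltY|exact: mgeZ].
- by apply: measurableI; [exact: meqY|exact: mgeB].
- by apply/seteqP; split => w // -[[+ _] [Yk _]]; rewrite Yk ltnn.
Qed.

Let delta n := \sum_(0 <= k < n) pi_ k * batch_tail b (n - k)%N.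

Let y_lim k : y i k @[i --> \oo] --> pi_ k.
Proof. by have /fine_cvgP[_] := @found_lim k. Qed.

Let sum_y_lim n : \sum_(k < n) y i k @[i --> \oo] --> \sum_(k < n) pi_ k.
Proof. by apply: (cvg_sum_nat (u := fun k i => y i k)) => k; exact: y_lim. Qed.

Let down i n w := ((n <= Z i w)%N && (Y i.+1 w < n)%N).

Let mdown i n : measurable [set w | down i n w].
Proof.
by apply/measurable_set_bool/measurable_and;
  [exact: measurable_fun_leq|exact: measurable_fun_ltn].
Qed.

Let mgeY i n : measurable [set w | (n <= Y i w)%N].
Proof. exact/measurable_set_bool/measurable_fun_leq. Qed.

Let Y_le_Z i w : (Y i.+1 w <= Z i w)%N.
Proof.
apply: leq_sum => j _.
have := arrival_epoch_monotone (X_proper w) (leqnSn i).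
by case: (ltP (arrival_epoch (X w) i.+1) _) => // h1 h2; rewrite (le_lt_trans h2).
Qed.

(** Up- and downcrossings of the level [n] alternate: between two arrivals their
    numbers differ by the change of the indicator of [n <= Y i w]. *)
Let level_down i n : prob P [set w | down i n w] =
  \sum_(k < n) y i k * batch_tail b (n - k)%N - \sum_(k < n) y i k
  + \sum_(k < n) y i.+1 k.
Proof.
have mgeZ : measurable [set w | (n <= Z i w)%N].
  exact/measurable_set_bool/measurable_fun_leq.
have geZ1 : prob P [set w | (n <= Z i w)%N] =
    prob P [set w | down i n w] + prob P [set w | (n <= Y i.+1 w)%N].
  rewrite -probU//.
    congr prob; apply/seteqP; split => w; rewrite /down /=.
      by move=> ->; case: (leqP n (Y i.+1 w)); [right|left].
    by move=> [/andP[]//|h]; exact: leq_trans h (Y_le_Z _ _).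
  apply/seteqP; split => w // -[/= /andP[_]]; by rewrite ltnNge => /negP.
have geZ2 : prob P [set w | (n <= Z i w)%N] =
    prob P [set w | (Y i w < n <= Z i w)%N] + prob P [set w | (n <= Y i w)%N].
  rewrite -probU//.
  - congr prob; apply/seteqP; split => w /=.
      by move=> ->; rewrite andbT; case: (leqP n (Y i w)); [right|left].
    by move=> [/andP[]//|h]; rewrite ZE (leq_trans h)// leq_addr.
  - apply: measurable_set_bool; apply: measurable_and.
      exact: measurable_fun_ltn.
    exact: measurable_fun_leq.
  - by apply/seteqP; split => w // -[/= /andP[+ _]]; rewrite ltnNge => /negP.
have := geZ1; rewrite geZ2 level_up !prob_ge//; rewrite -/(y _ _); lra.
Qed.

Let level_down_lim n : prob P [set w | down i n w] @[i --> \oo] --> delta n.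
Proof.
under eq_fun do rewrite level_down.
have -> : delta n = \sum_(k < n) pi_ k * batch_tail b (n - k)%N
    - \sum_(k < n) pi_ k + \sum_(k < n) pi_ k.
  by rewrite subrK /delta big_mkord.
apply: cvgD; first apply: cvgB.
- apply: (cvg_sum_nat (u := fun k i => y i k * batch_tail b (n - k)%N)
    (l := fun k => pi_ k * batch_tail b (n - k)%N)) => k.
  by apply: cvgMr_tmp; exact: y_lim.
- exact: sum_y_lim.
- by have := @sum_y_lim n; rewrite -cvg_shiftS.
Qed.

Lemma mean_sojourn_lim n : (0 < n)%N ->
  mean_sojourn P c X i n @[i --> \oo] --> delta n / (mu * (minn n c)%:R).
Proof.
move=> n0; have rate0 : 0 < mu * (minn n c)%:R.
  by rewrite mulr_gt0// ltr0n leq_min n0.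
have sojournE i : mean_sojourn P c X i n =
    prob P [set w | down i n w] / (mu * (minn n c)%:R).
  have := cycle_balance c_gt0 mu_gt0 X_proper mX X_indep service_law i n0.
  rewrite -[LHS]/(P [set w | down i n w]) probE//.
  have -> : (\int[P]_w lebesgue_measure (cycle_slice c X i n w))%E =
      (mean_sojourn P c X i n)%:E.
    by rewrite -(mean_sojournE c_gt0 X_proper mX gap_mean_eq)// cycle_sliceE// volE.
  by rewrite -EFinM => -[->]; rewrite mulrAC mulfV ?mul1r// gt_eqF.
under eq_fun do rewrite sojournE.
by apply: cvgMr_tmp; exact: level_down_lim.
Qed.

Let gap_indep l k V W : l != k -> measurable V -> measurable W ->
  (P ((fun w => gap (X w) l) @^-1` V `&` (fun w => gap (X w) k) @^-1` W) =
   P ((fun w => gap (X w) l) @^-1` V) * P ((fun w => gap (X w) k) @^-1` W))%E.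
Proof.
move=> lk mV mW; pose s j : unit + (nat + (nat + nat)) := inr (inl j).
apply: (independent_other_events (@input_events_setT _ _ _ X)
  (@input_events_setI _ _ _ X) (input_events_measurable mX) X_indep (k := s k)).
  apply: sub_sigma_algebra; apply: (sub_other_events (@input_events_setT _ _ _ X)
    (i := s l)); last exact: (generated_eventsP (fun w => gap (X w) l) mV).
  by apply: contra lk => /eqP[->].
exact: (generated_eventsP (fun w => gap (X w) k) mW).
Qed.

Let g l w := gap (X w) l.

Let mg l : measurable_fun setT (g l).
Proof. exact: measurable_gap. Qed.

Let g_ge0 l w : 0 <= g l w.
Proof. exact: gap_nonneg. Qed.

(** The mean excess over [M] is the integral of the tail [1 - A] from [M] on,
    hence the same for all interarrival times. *)
Let gap_excess_eq l M :
  (\int[P]_w (excess g l M w)%:E = \int[P]_w (excess g 0 M w)%:E)%E.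
Proof.
suff tail k : (\int[P]_w (excess g k M w)%:E =
    \int[lebesgue_measure]_s (if (M <= s)%R then (1 - A s)%:E else 0))%E.
  by rewrite !tail.
pose K := [set ws : T * R | (M <= ws.2 < g k ws.1)%R].
have mK : measurable K.
  apply: measurable_set_bool; apply: measurable_and; first exact: measurable_fun_ler.
  by apply: measurable_fun_ltr => //; exact: (measurableT_comp (mg k)).
have := tonelli_sections P lebesgue_measure mK.
rewrite /K /=; under eq_integral do rewrite lebesgue_measure_itvco.
move=> ->; apply: eq_integral => s _.
case: (leP M s) => Ms /=; last first.
  rewrite (_ : mkset _ = set0) ?measure0//.
  by apply/seteqP; split => w.
rewrite (_ : mkset _ = ~` [set w | gap (X w) k <= s]); last first.
  by apply/seteqP; split => w /=; rewrite /g ltNge => /negP.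
rewrite probability_setC ?gap_law//.
by apply: measurable_set_bool; apply: measurable_fun_ler => //; exact: mg.
Qed.

Let sojourn_average n :
  N%:R^-1 * \sum_(i < N) mean_sojourn P c X i n @[N --> \oo] --> p n * m.
Proof.
apply: time_average => // eps eps0.
exact: (law_of_large_numbers mg g_ge0 gap_mean_eq gap_indep gap_excess_eq eps0).
Qed.

(** The mean time spent with [n] customers between two arrivals has a limit by the
    balance of crossings, and its averages tend to [p n * m]. *)
Lemma stationary_level n : (0 < n)%N ->
  p n * m = delta n / (mu * (minn n c)%:R).
Proof.
move=> n0; have h := cvg_mean (mean_sojourn_lim n0).
exact: (cvg_unique _ (@sojourn_average n) h).
Qed.

Let below i K : set (T * R) := window X i i.+1 `&`
  [set ws | (number_left c (X ws.1) (customers_before (X ws.1) i.+1) ws.2 < K)%N].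

Let mleft i : measurable_fun setT (fun ws : T * R =>
  number_left c (X ws.1) (customers_before (X ws.1) i.+1) ws.2).
Proof.
have mX1 := measurable_input_comp (@measurable_fst _ _ T R) mX.
apply: (measurable_number_left c_gt0 mX1) => //.
exact: (measurable_customers_before mX1).
Qed.

Let mbelow i K : measurable (below i K).
Proof.
apply: measurableI; first exact: measurable_window.
exact/measurable_set_bool/measurable_fun_ltn.
Qed.

Local Notation vol := (P \x @lebesgue_measure R)%E.

Let vol_below i K : vol (below i K) = (\sum_(n < K) mean_sojourn P c X i n)%:E.
Proof.
elim: K => [|K IHK].
  rewrite big_ord0 (_ : below i 0 = set0) ?measure0//.
  by apply/seteqP; split => // ws [].
rewrite big_ord_recr /= EFinD -IHK -(mean_sojournE c_gt0 X_proper mX gap_mean_eq)//.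
rewrite cycle_sliceE// -measureU//.
- congr (vol _); apply/seteqP; split => -[w s]; rewrite /below /window /cycle_slice /=.
    move=> [cell]; rewrite ltnS leq_eqVlt cell /= => /predU1P[->|h]; last by left.
    by right; rewrite eqxx.
  by move=> [[-> /ltnW]|/andP[-> /eqP ->]].
- exact: mbelow.
- exact: (measurable_cycle_slice c_gt0 mX).
- apply/seteqP; split => // -[w s]; rewrite /below /cycle_slice /=.
  by move=> [[_ h] /andP[_ /eqP e]]; move: h; rewrite e ltnn.
Qed.

Let sum_sojourn_le i K : \sum_(n < K) mean_sojourn P c X i n <= m.
Proof.
rewrite -lee_fin -vol_below -(vol_window X_proper gap_mean_eq i).
apply: le_measure; rewrite ?inE; last by move=> ws [].
- exact: mbelow.
- exact: (measurable_window mX).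
Qed.

(** The time spent with many customers in the system is small on average: the
    parts of the interarrival times beyond [L] have a small mean, and what remains,
    at most [L], counts only if the batch finds or brings many customers. *)
Let sum_sojourn_ge i K (L : R) : 0 <= L ->
  m <= \sum_(n < K + K) mean_sojourn P c X i n + mean_excess P g L +
       L * (1 - \sum_(k < K) y i k + batch_tail b K).
Proof.
move=> L0; set K2 := (K + K)%N.
have mgeZ : measurable [set w | (K2 <= Z i w)%N].
  exact/measurable_set_bool/measurable_fun_leq.
have mwin := measurable_window mX i i.+1.
pose above := window X i i.+1 `\` below i K2.
have mabove : measurable above by exact: measurableD.
have vol_above : (vol above <= (mean_excess P g L + L * prob P [set w | (K2 <= Z i w)%N])%:E)%E.
  rewrite volE EFinD EFinM -probE//.
  rewrite -(mean_excessE mg g_ge0 gap_mean_eq gap_excess_eq i L0).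
  have -> : P [set w | (K2 <= Z i w)%N] =
      (\int[P]_w (\1_[set w | (K2 <= Z i w)%N] w)%:E)%E.
    by rewrite integral_indic ?setIT.
  have mind : measurable_fun setT (fun w => (\1_[set w | (K2 <= Z i w)%N] w : R)%:E).
    exact/measurable_EFinP/measurable_indic.
  rewrite -ge0_integralZl// -ge0_integralD//; last 4 first.
  - by move=> w _; rewrite lee_fin excess_ge0.
  - exact/measurable_EFinP/measurable_excess.
  - by move=> w _; rewrite -EFinM lee_fin mulr_ge0.
  - exact: emeasurable_funM.
  apply: ge0_le_integral => //.
  - exact: (measurable_measure_xsection lebesgue_measure mabove).
  - apply: emeasurable_funD; last exact: emeasurable_funM.
    exact/measurable_EFinP/measurable_excess.
  move=> w _; rewrite -EFinM -EFinD indicE.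
  have Lrhs : 0 <= excess g i L w by exact: excess_ge0.
  case: (leqP K2 (Z i w)) => KZ.
    rewrite mem_set// mulr1.
    apply: (@le_trans _ _ (lebesgue_measure
      [set s | arrival_epoch (X w) i <= s < arrival_epoch (X w) i.+1])).
      apply: le_measure; rewrite ?inE; last by move=> s [].
        exact: (measurable_xsection_set mabove w).
      exact: measurable_itvco.
    rewrite lebesgue_measure_itvco arrival_epochS lee_fin ge_max.
    rewrite addr_ge0// andbT /excess /g; case: (leP (gap (X w) i - L) 0); lra.
  rewrite (_ : mkset _ = set0) ?measure0.
    by rewrite lee_fin addr_ge0// mulr_ge0.
  apply/seteqP; split => // s [/= win]; apply; split => //=.
  apply: leq_ltn_trans KZ; apply: leq_sum => j _.
  move: win; rewrite /window /= => /andP[lo _].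
  by case: (ltP s _) => // h; rewrite (le_lt_trans lo h).
have : (vol (window X i i.+1) <= vol (below i K2) + vol above)%E.
  have mU : measurable (below i K2 `|` above).
    by apply: measurableU; [exact: mbelow|exact: mabove].
  apply: (@le_trans _ _ (vol (below i K2 `|` above))); last first.
    exact: (measureU2 vol (@mbelow i K2) mabove).
  apply: le_measure; rewrite ?inE; [exact: mwin|exact: mU|].
  by move=> ws win; have [h|h] := pselect (below i K2 ws); [left|right].
rewrite (vol_window X_proper gap_mean_eq) vol_below.
move=> /le_trans /(_ (leeD2l _ vol_above)); rewrite -EFinD lee_fin.
have geK : prob P [set w | (K2 <= Z i w)%N] <=
    1 - \sum_(k < K) y i k + batch_tail b K.
  rewrite -prob_ge// -(batch_tail_prob i).
  apply: (@le_trans _ _ (prob P ([set w | (K <= Y i w)%N] `|`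
    [set w | (K <= batch_size (X w) i)%N]))).
    apply: prob_le => //; first exact: measurableU.
    move=> w /=; rewrite ZE /K2 => h.
    by case: (leqP K (Y i w)) => hY; [left|right => /=; lia].
  rewrite -lee_fin EFinD -!probE//; last exact: measurableU.
  exact: measureU2.
have := ler_wpM2l L0 geK; lra.
Qed.

Let p_ge0 n : 0 <= p n.
Proof.
have h : P [set w | (in_system c (X w) t #= `I_n)%card] @[t --> +oo] --> (p n)%:E.
  exact: time_lim.
by rewrite -lee_fin; apply: (cvge_to_ge h); apply: nearW => s; exact: measure_ge0.
Qed.

Let sum_average K : N%:R^-1 * \sum_(i < N) \sum_(n < K) mean_sojourn P c X i n
  @[N --> \oo] --> (\sum_(n < K) p n) * m.
Proof.
rewrite mulr_suml; under eq_fun do rewrite exchange_big mulr_sumr.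
apply: (cvg_sum_nat
  (u := fun n N => N%:R^-1 * \sum_(i < N) mean_sojourn P c X i n)
  (l := fun n => p n * m)) => n.
exact: sojourn_average.
Qed.

Let sum_p_le K : \sum_(n < K) p n <= 1.
Proof.
rewrite -(ler_pM2r m_gt0) mul1r; apply: (cvgr_to_le (sum_average (K := K))).
near=> N; have N0 : 0 < N%:R :> R by rewrite ltr0n; near: N; exact: nbhs_infty_gt.
rewrite ler_pdivrMl//; apply: (@le_trans _ _ (\sum_(i < N) m)).
  by apply: ler_sum => i _; exact: sum_sojourn_le.
by rewrite sumr_const card_ord mulr_natl.
Unshelve. all: by end_near.
Qed.

Let sum_p_ge K (L : R) : 0 <= L -> m <= (\sum_(n < K + K) p n) * m +
  mean_excess P g L + L * (1 - \sum_(k < K) pi_ k + batch_tail b K).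
Proof.
move=> L0; pose u i := L * (1 - \sum_(k < K) y i k + batch_tail b K).
have u_lim : u i @[i --> \oo] --> L * (1 - \sum_(k < K) pi_ k + batch_tail b K).
  apply: cvgMl_tmp; apply: cvgD; last exact: cvg_cst.
  by apply: cvgB; [exact: cvg_cst|exact: sum_y_lim].
have h : N%:R^-1 * \sum_(i < N) \sum_(n < K + K) mean_sojourn P c X i n +
    mean_excess P g L + N%:R^-1 * \sum_(i < N) u i @[N --> \oo] -->
    (\sum_(n < K + K) p n) * m + mean_excess P g L +
    L * (1 - \sum_(k < K) pi_ k + batch_tail b K).
  apply: cvgD; last exact: cvg_mean.
  by apply: cvgD; [exact: sum_average|exact: cvg_cst].
apply: (cvgr_to_ge h); near=> N.
have N0 : 0 < N%:R :> R by rewrite ltr0n; near: N; exact: nbhs_infty_gt.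
have cst_mean (a : R) : a = N%:R^-1 * \sum_(i < N) a.
  by rewrite sumr_const card_ord -[a *+ N]mulr_natl mulKf// gt_eqF.
rewrite [leLHS]cst_mean [X in _ + X + _]cst_mean -!mulrDr ler_pM2l ?invr_gt0//.
rewrite -!big_split/=; apply: ler_sum => i _; exact: sum_sojourn_ge.
Unshelve. all: by end_near.
Qed.

Let pi_ge0 k : 0 <= pi_ k.
Proof.
have h : P [set w | number_found c (X w) i = k] @[i --> \oo] --> (pi_ k)%:E.
  exact: found_lim.
by rewrite -lee_fin; apply: (cvge_to_ge h); apply: nearW => i; exact: measure_ge0.
Qed.

Let sum_pi_lim : \sum_(k < K) pi_ k @[K --> \oo] --> (1 : R).
Proof.
have h : cvgn (fun n => \sum_(0 <= k < n) (pi_ k)%:E)%E.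
  by apply: is_cvg_nneseries => k _ _; rewrite lee_fin.
suff : (\sum_(k < K) pi_ k)%:E @[K --> \oo] --> 1%:E by move/fine_cvgP => [].
rewrite -pi_sum; under eq_fun do rewrite -sumEFin -(big_mkord xpredT (fun k => (pi_ k)%:E)).
exact: h.
Qed.

Let batch_tail_lim : batch_tail b K @[K --> \oo] --> (0 : R).
Proof.
pose F K := [set w | (K <= batch_size (X w) 0)%N].
have F0 : \bigcap_K F K = set0.
  apply/seteqP; split => // w /(_ (batch_size (X w) 0).+1 I).
  by rewrite /F /= ltnn.
have := @nonincreasing_cvg_mu _ _ _ P F.
rewrite F0 measure0 => h.
suff : (batch_tail b K)%:E @[K --> \oo] --> 0%:E by move/fine_cvgP => [].
under eq_fun do rewrite -(batch_tailE 0).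
apply: h => //.
- by rewrite -ge0_fin_numE// fin_num_measure//; exact: mgeB.
- by move=> K; exact: mgeB.
- move=> K K' KK'; apply/subsetPset => w; rewrite /F /=; exact: leq_trans.
Qed.

Let sum_p_lim : \sum_(k < K) p k @[K --> \oo] --> (1 : R).
Proof.
apply/cvgrPdist_le => eps eps0.
have e2 : 0 < eps * m / 2 by rewrite divr_gt0 ?mulr_gt0.
(* [L] has to be chosen before [K], since it multiplies the tail term. *)
have [L0 _ L0P] : \forall M \near \oo, mean_excess P g M%:R <= eps * m / 2.
  have /cvgrPdist_le := cvg_mean_excess mg g_ge0 gap_mean_eq.
  move=> /(_ _ e2); apply: filterS => M; rewrite sub0r normrN; exact/le_trans/ler_norm.
set L : R := L0%:R; have eL : mean_excess P g L <= eps * m / 2 := L0P L0 (leqnn L0).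
have tail_lim : L * (1 - \sum_(k < K) pi_ k + batch_tail b K) @[K --> \oo] --> (0 : R).
  rewrite -[X in _ --> X](mulr0 L); apply: cvgMl_tmp.
  rewrite -[X in _ --> X](addr0 0); apply: cvgD; last exact: batch_tail_lim.
  by rewrite -[X in _ --> X](subrr 1); apply: cvgB; [exact: cvg_cst|exact: sum_pi_lim].
have [K _ KP] : \forall K \near \oo,
    L * (1 - \sum_(k < K) pi_ k + batch_tail b K) <= eps * m / 2.
  move/cvgrPdist_le : tail_lim => /(_ _ e2); apply: filterS => K.
  rewrite sub0r normrN; exact/le_trans/ler_norm.
have geK := sum_p_ge K (ler0n R L0 : 0 <= L).
have {}geK : 1 - eps <= \sum_(n < K + K) p n.
  rewrite -(ler_pM2r m_gt0) mulrBl mul1r; have := KP K (leqnn K); lra.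
near=> N.
have : \sum_(n < K + K) p n <= \sum_(n < N) p n.
  rewrite -!(big_mkord xpredT p) [leRHS](big_cat_nat (n := (K + K)%N))//=.
    by rewrite lerDl sumr_ge0.
  by near: N; exact: nbhs_infty_ge.
have := sum_p_le N; rewrite ler_norml; lra.
Unshelve. all: by end_near.
Qed.

Lemma stationary_sum : (\sum_(0 <= k <oo) (p k)%:E = 1)%E.
Proof.
apply: cvg_lim => //.
under eq_fun do rewrite big_mkord sumEFin.
by apply: cvg_EFin; [apply: nearW|exact: sum_p_lim].
Qed.

Lemma stationary_zero : ((p 0%N)%:E = 1 - \sum_(1 <= k <oo) (p k)%:E)%E.
Proof.
have := stationary_sum; rewrite (nneseries_split 0 1); last first.
  by move=> k _; rewrite lee_fin.
rewrite add0n big_nat1; have : (0 <= \sum_(1 <= k <oo) (p k)%:E)%E.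
  by apply: nneseries_ge0 => k _ _; rewrite lee_fin.
case: (\sum_(1 <= k <oo) _)%E => [s| |] // _.
by rewrite -EFinD => -[<-]; rewrite -EFinB addrK.
Qed.

End Stationary.

(** * Almost surely proper data *)

Section ProperVersion.
Context d (T : measurableType d) (R : realType) (P : probability T R).

Lemma eq_measure_ae (A B : set T) : measurable A -> measurable B ->
  {ae P, forall w, A w <-> B w} -> P A = P B.
Proof.
move=> mA mB AB; rewrite -[A]setIT -[B]setIT -!integral_indic//.
apply: ae_eq_integral => //; try exact/measurable_EFinP/measurable_indic.
apply: filterS AB => w AB _; rewrite !indicE; congr ((nat_of_bool _)%:R%:E).
by apply/idP/idP; rewrite !in_setE => /AB.
Qed.

(** Repairing the data on a null set makes the sample path properties hold
    everywhere and changes no probability. *)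
Definition proper_version (x : queue_input R) :=
  QueueInput (initial x) (first_arrival x) (fun i => Num.max (gap x i) 0)
    (fun i => maxn (batch_size x i) 1)
    (fun j => if 0 < service x j then service x j else 1).

Lemma proper_version_id x : proper_input x -> proper_version x = x.
Proof.
case: x => i f g b s [_ /= g0 b0 s0]; rewrite /proper_version /=.
congr QueueInput; apply/funext => k.
- exact/max_idPl.
- exact/maxn_idPl.
- by rewrite s0.
Qed.

Lemma proper_version_proper x : 0 <= first_arrival x -> proper_input (proper_version x).
Proof.
move=> f0; split => //= k; first by rewrite le_max lexx orbT.
  by rewrite leq_max orbT.
by case: ifP.
Qed.

Lemma measurable_proper_version (X : T -> queue_input R) :
  measurable_input X -> measurable_input (proper_version \o X).
Proof.
move=> [m1 m2 m3 m4 m5]; split => //= k.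
- by apply: measurable_maxr => //; exact: measurable_cst.
- by apply: measurable_fun_maxn; [exact: m4|exact: measurable_cst].
- apply: measurable_fun_ifT => //.
  by apply: measurable_fun_ltr => //; exact: measurable_cst.
Qed.

Lemma generated_events_comp d1 d2 (U : measurableType d1) (V : measurableType d2)
    (f : T -> U) (h : U -> V) : measurable_fun setT h ->
  generated_events (h \o f) `<=` generated_events f.
Proof.
move=> mh _ [B mB <-]; exists (h @^-1` B); last by rewrite -comp_preimage.
by rewrite -[X in measurable X]setTI; exact: mh.
Qed.

Lemma input_events_proper_version (X : T -> queue_input R) i :
  input_events (proper_version \o X) i `<=` input_events X i.
Proof.
case: i => [[]|[k|[k|k]]] //=.
- apply: (generated_events_comp (h := fun t : R => Num.max t 0)).
  by apply: measurable_maxr => //; exact: measurable_cst.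
- exact: (generated_events_comp (h := fun t : nat => maxn t 1)).
- apply: (generated_events_comp (h := fun t : R => if 0 < t then t else 1)).
  apply: measurable_fun_ifT => //.
  by apply: measurable_fun_ltr => //; exact: measurable_cst.
Qed.

Lemma mutually_independentS (I : eqType) (F G : I -> set (set T)) :
  (forall i, G i `<=` F i) -> mutually_independent P F -> mutually_independent P G.
Proof. by move=> GF indF s E us GE; apply: indF => // i /GE/GF. Qed.

End ProperVersion.

Section SampleInput.
Context d (T : measurableType d) (R : realType) (P : probability T R).
Variables (A : R -> R) (lambda : R) (b : nat -> R) (mu : R) (Q : queue_rvs P).
Hypothesis Q_GIXMc : is_GIXMc A lambda b mu Q.

Lemma measurable_sample : measurable_input (sample Q).
Proof. by split => [||i|i|j] /=; exact: measurable_funPT. Qed.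

Lemma ae_gap_ge0 i : {ae P, forall w, 0 <= gap (sample Q w) i}.
Proof.
have m n : measurable [set w | gap (sample Q w) i <= - n.+1%:R^-1].
  apply/measurable_set_bool/measurable_fun_ler; last exact: measurable_cst.
  exact: (measurable_gap measurable_sample i).
suff : P.-negligible (~` [set w | 0 <= gap (sample Q w) i]) by [].
apply: (negligibleS
  (A := \bigcup_n [set w | gap (sample Q w) i <= - n.+1%:R^-1])).
  move=> w /= /negP; rewrite -ltNge -oppr_gt0 => neg.
  exists (Num.bound (- gap (sample Q w) i)^-1) => //=.
  rewrite lerNr -[leRHS]invrK lef_pV2 ?posrE ?invr_gt0//.
  rewrite (le_trans (ltW (archi_boundP _))) ?ler_nat// invr_ge0 ltW//.
apply: negligible_bigcup => n; apply/negligibleP => //.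
have := gap_cdf Q_GIXMc i (- n.+1%:R^-1).
rewrite (interarrival_ge0 Q_GIXMc) ?oppr_lt0 ?invr_gt0// => <-.
Qed.

Lemma ae_batch_size_gt0 i : {ae P, forall w, (0 < batch_size (sample Q w) i)%N}.
Proof.
exists [set w | batch_size_rv Q i w = 0%N]; split.
- have := @measurable_funPT _ _ _ _ (batch_size_rv Q i) measurableT [set 0%N] I.
  by rewrite setTI.
- by rewrite (batch_size_pmf Q_GIXMc) (batch_size_gt0 Q_GIXMc).
- by move=> w /= /negP; rewrite lt0n negbK => /eqP.
Qed.

Lemma ae_service_gt0 j : {ae P, forall w, 0 < service (sample Q w) j}.
Proof.
exists [set w | service_rv Q j w <= 0]; split.
- apply/measurable_set_bool/measurable_fun_ler; first exact: measurable_funPT.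
  exact: measurable_cst.
- have := service_exponential Q_GIXMc j (measurable_itv `]-oo, 0]).
  rewrite /distribution /pushforward.
  rewrite (_ : _ @^-1` _ = [set w | service_rv Q j w <= 0]); last first.
    by apply/seteqP; split => w /=; rewrite in_itv.
  move=> ->; rewrite /exponential_prob -integral_itv_bndo_bndc.
    rewrite integral0_eq// => y /=; rewrite in_itv/= => y0.
    by rewrite lt0_exponential_pdf.
  apply: measurable_funTS; apply/measurable_EFinP.
  exact: measurable_exponential_pdf.
- by move=> w /= /negP; rewrite -leNgt.
Qed.

Lemma ae_sample_proper : {ae P, forall w, proper_version (sample Q w) = sample Q w}.
Proof.
have gaps : {ae P, forall w, forall i, 0 <= gap (sample Q w) i}.
  by apply/ae_foralln => i; exact: ae_gap_ge0.
have batches : {ae P, forall w, forall i, (0 < batch_size (sample Q w) i)%N}.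
  by apply/ae_foralln => i; exact: ae_batch_size_gt0.
have services : {ae P, forall w, forall j, 0 < service (sample Q w) j}.
  by apply/ae_foralln => j; exact: ae_service_gt0.
apply: filterS3 gaps batches services => w w1 w2 w3.
by apply: proper_version_id; split => //; exact: first_arrival_ge0 Q_GIXMc w.
Qed.

Lemma proper_version_prob (E : queue_input R -> Prop) :
  measurable [set w | E (sample Q w)] ->
  measurable [set w | E (proper_version (sample Q w))] ->
  P [set w | E (proper_version (sample Q w))] = P [set w | E (sample Q w)].
Proof.
move=> m1 m2; apply: eq_measure_ae => //.
by have := ae_sample_proper; apply: filterS => w /= ->.
Qed.

End SampleInput.

(** * The time-average distribution *)

Theorem lemma3p2 (d : measure_display) (T : measurableType d) (R : realType)
    (P : probability T R) (c : nat) (A : R -> R) (lambda : R) (b : nat -> R)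
    (mu : R) (Q : queue_rvs P) (pi_ p : nat -> R) :
  (1 <= c)%N -> 0 < lambda -> 0 < mu ->
  is_GIXMc A lambda b mu Q ->
  (traffic_intensity c lambda b mu < 1)%E ->
  is_pre_arrival_distribution c Q pi_ ->
  is_time_limit c Q p ->
  (forall n : nat, (1 <= n)%N ->
     p n = lambda * (\sum_(0 <= k < n) pi_ k * batch_tail b (n - k)%N)
           / ((minn n c)%:R * mu)) /\
  ((p 0%N)%:E = 1 - \sum_(1 <= k <oo) (p k)%:E)%E.
Proof.
move=> c_gt0 lambda_gt0 mu_gt0 Q_model _ [pi_lim pi_sum] p_lim.
pose X w := proper_version (sample Q w).
have mS : measurable_input (sample Q) := measurable_sample Q.
have mX : measurable_input X := measurable_proper_version mS.
have X_proper w : proper_input (X w).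
  by apply: proper_version_proper; exact: first_arrival_ge0 Q_model w.
have X_indep : mutually_independent P (input_events X).
  apply: (mutually_independentS (F := input_events (sample Q))).
    by move=> i; exact: input_events_proper_version.
  apply: (mutually_independentS _ (sources_independent Q_model)).
  by move=> [[]|[k|[k|k]]].
have service_law j V : measurable V ->
    P [set w | V (service (X w) j)] = exponential_prob mu V.
  move=> mV; rewrite -(service_exponential Q_model j mV).
  have mpre Y : measurable_input Y -> measurable [set w | V (service (Y w) j)].
    by move=> mY; have := measurable_service mY j measurableT mV; rewrite setTI.
  by rewrite (proper_version_prob Q_model (E := fun x => V (service x j)))//;
    exact: mpre.
have gap_law i t : P [set w | gap (X w) i <= t] = (A t)%:E.
  rewrite -(gap_cdf Q_model i t).
  have mpre Y : measurable_input Y -> measurable [set w | gap (Y w) i <= t].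
    move=> mY; apply/measurable_set_bool/measurable_fun_ler; first exact: measurable_gap.
    exact: measurable_cst.
  rewrite (proper_version_prob Q_model (E := fun x => gap x i <= t));
    [|exact: mpre|exact: mpre].
  rewrite /cdf /distribution /pushforward; congr (P _).
have gap_mean_eq i : (\int[P]_w (gap (X w) i)%:E = (lambda^-1)%:E)%E.
  rewrite -(gap_mean Q_model i) expectation_def.
  apply: ae_eq_integral => //.
  - by apply/measurable_EFinP; exact: measurable_gap.
  - by apply/measurable_EFinP; exact: measurable_funPT.
  - by have := ae_sample_proper Q_model; apply: filterS => w; rewrite /X => ->.
have batch_law i k : P [set w | batch_size (X w) i = k] = (b k)%:E.
  rewrite -(batch_size_pmf Q_model i k).
  have mpre Y : measurable_input Y -> measurable [set w | batch_size (Y w) i = k].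
    move=> mY; have := measurable_batch_size mY i measurableT (Y := [set k]) I.
    by rewrite setTI.
  by rewrite (proper_version_prob Q_model (E := fun x => batch_size x i = k));
    [|exact: mpre|exact: mpre].
have found_lim k : P [set w | number_found c (X w) i = k] @[i --> \oo] --> (pi_ k)%:E.
  rewrite (_ : (fun i => _) =
    fun i => P [set w | found_by_batch c (sample Q w) i = k]); first exact: pi_lim.
  apply/funext => i.
  have mpre Y : measurable_input Y -> measurable [set w | number_found c (Y w) i = k].
    move=> mY; have mN : measurable_fun setT (fun w => number_found c (Y w) i).
      apply: measurable_number_left => //; first exact: measurable_customers_before.
      exact: measurable_arrival_epoch.
    by have := mN measurableT [set k] I; rewrite setTI.
  rewrite -[RHS]/(P [set w | number_found c (sample Q w) i = k]).
  apply: (proper_version_prob Q_model (E := fun x => number_found c x i = k)).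
    exact: mpre mS.
  exact: mpre mX.
have time_lim n : P [set w | (in_system c (X w) t #= `I_n)%card] @[t --> +oo] --> (p n)%:E.
  rewrite (_ : (fun t => _) =
    fun t => P [set w | (in_system c (sample Q w) t #= `I_n)%card]); first exact: p_lim.
  apply/funext => t.
  have mpre Y : measurable_input Y ->
      measurable [set w | (in_system c (Y w) t #= `I_n)%card].
    move=> mY; apply: (measurable_number_in_system c_gt0 mY (t := cst t)).
    exact: measurable_cst.
  apply: (proper_version_prob Q_model (E := fun x => (in_system c x t #= `I_n)%card)).
    exact: mpre mS.
  exact: mpre mX.
have m_gt0 : 0 < lambda^-1 by rewrite invr_gt0.
split; last exact: (stationary_zero c_gt0 m_gt0 mu_gt0 X_proper mX X_indep
  gap_mean_eq gap_law batch_law found_lim pi_sum time_lim).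
move=> n n_gt0; have := stationary_level c_gt0 m_gt0 mu_gt0 X_proper mX X_indep
  service_law gap_mean_eq gap_law batch_law found_lim time_lim n_gt0.
move=> /(congr1 ( *%R^~ lambda)); rewrite mulfVK ?gt_eqF// => ->.
by rewrite [in RHS](mulrC _ mu) mulrAC (mulrC lambda).
Qed.
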